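(* If $X$ is a reflexive infinite-dimensional real Banach lattice, then the closed unit ball $\mathbf B(X)$ has uncountably many order extreme points.
   Context: A point $a\in A$ is an order extreme point of $A$ if for all $x_0,x_1\in A$ and $t\in(0,1)$, $a\le(1-t)x_0+tx_1$ implies $x_0=a=x_1$. *)

(* Defs.v *)
From Stdlib Require Import Reals.
Open Scope R_scope.

Record BanachLattice := {
  carrier :> Type;
  vzero : carrier;
  vadd : carrier -> carrier -> carrier;
  vopp : carrier -> carrier;
  vscal : R -> carrier -> carrier;
  vadd_assoc : forall x y z, vadd x (vadd y z) = vadd (vadd x y) z;
  vadd_comm : forall x y, vadd x y = vadd y x;
  vadd_0 : forall x, vadd x vzero = x;
  vadd_opp : forall x, vadd x (vopp x) = vzero;
  vscal_1 : forall x, vscal 1 x = x;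
  vscal_assoc : forall a b x, vscal a (vscal b x) = vscal (a * b) x;
  vscal_distr_r : forall a x y, vscal a (vadd x y) = vadd (vscal a x) (vscal a y);
  vscal_distr_l : forall a b x, vscal (a + b) x = vadd (vscal a x) (vscal b x);
  vnorm : carrier -> R;
  vnorm_nonneg : forall x, 0 <= vnorm x;
  vnorm_eq0 : forall x, vnorm x = 0 -> x = vzero;
  vnorm_scal : forall a x, vnorm (vscal a x) = Rabs a * vnorm x;
  vnorm_triangle : forall x y, vnorm (vadd x y) <= vnorm x + vnorm y;
  vcomplete : forall u : nat -> carrier,
    (forall eps, 0 < eps -> exists N, forall m n, (N <= m)%nat -> (N <= n)%nat ->
        vnorm (vadd (u m) (vopp (u n))) < eps) ->
    exists l, forall eps, 0 < eps -> exists N, forall n, (N <= n)%nat ->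
        vnorm (vadd (u n) (vopp l)) < eps;
  vle : carrier -> carrier -> Prop;
  vle_refl : forall x, vle x x;
  vle_antisym : forall x y, vle x y -> vle y x -> x = y;
  vle_trans : forall x y z, vle x y -> vle y z -> vle x z;
  vle_add : forall x y z, vle x y -> vle (vadd x z) (vadd y z);
  vle_scal : forall a x y, 0 <= a -> vle x y -> vle (vscal a x) (vscal a y);
  vjoin : carrier -> carrier -> carrier;
  vjoin_l : forall x y, vle x (vjoin x y);
  vjoin_r : forall x y, vle y (vjoin x y);
  vjoin_lub : forall x y z, vle x z -> vle y z -> vle (vjoin x y) z;
  vnorm_lattice : forall x y,
    vle (vjoin x (vopp x)) (vjoin y (vopp y)) -> vnorm x <= vnorm y
}.

Section Defs.
Variable X : BanachLattice.

Definition is_dual_elt (f : X -> R) : Prop :=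
  (forall x y, f (vadd X x y) = f x + f y) /\
  (forall a x, f (vscal X a x) = a * f x) /\
  (exists M, forall x, Rabs (f x) <= M * vnorm X x).

(** Bounded linear functionals on the dual X*: [phi] is linear on X* and
    |phi f| <= C ||f||_{X*}, written without the sup as: whenever
    |f x| <= M ||x|| for all x, then |phi f| <= C M. *)
Definition is_bidual_elt (phi : (X -> R) -> R) : Prop :=
  (forall f g, is_dual_elt f -> is_dual_elt g ->
     phi (fun x => f x + g x) = phi f + phi g) /\
  (forall a f, is_dual_elt f -> phi (fun x => a * f x) = a * phi f) /\
  (exists C, forall f M, is_dual_elt f ->
     (forall x, Rabs (f x) <= M * vnorm X x) -> Rabs (phi f) <= C * M).

Definition reflexive : Prop :=
  forall phi, is_bidual_elt phi ->
    exists x, forall f, is_dual_elt f -> phi f = f x.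

Fixpoint lincomb (c : nat -> R) (v : nat -> X) (n : nat) : X :=
  match n with
  | O => vzero X
  | S n' => vadd X (lincomb c v n') (vscal X (c n') (v n'))
  end.

Definition infinite_dimensional : Prop :=
  forall n : nat, exists v : nat -> X,
    forall c : nat -> R, lincomb c v n = vzero X ->
      forall i, (i < n)%nat -> c i = 0.

Definition unit_ball (x : X) : Prop := vnorm X x <= 1.

Definition order_extreme_point (A : X -> Prop) (a : X) : Prop :=
  A a /\
  forall x0 x1 t, A x0 -> A x1 -> 0 < t < 1 ->
    vle X a (vadd X (vscal X (1 - t) x0) (vscal X t x1)) ->
    x0 = a /\ a = x1.

Definition countable_set (S : X -> Prop) : Prop :=
  exists f : nat -> X, forall a, S a -> exists n, f n = a.

End Defs.

(* Main.v *)
(** Suppose the order extreme points are among a_0, a_1, ... An infinite-dimensional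
    reflexive Banach lattice has no order unit, so for every u >= 0 there are
    positive functionals that are large on the unit ball and small at u. Adding
    such functionals one after the other yields an increasing sequence f_n of
    positive functionals with norms 1 - 2^-n, the n-th increment being at most
    2^-(n+2) at |a_0| + ... + |a_n|. Its pointwise limit f has norm 1 but
    f (a_j) < 1 for all j. On the other hand, by a Krein-Milman argument on order
    faces, f attains its norm at an order extreme point. *)

Require Import Defs.
From mathcomp Require classical_sets all_boot all_algebra Rstruct.
From Stdlib Require Import Reals Lra Lia Classical ClassicalEpsilon
  FunctionalExtensionality PropExtensionality.
Open Scope R_scope.

(** * Hahn-Banach theorem *)

(** Without reflexivity an order unit can exist in any dimension, as in C(K), so excluding it is the
    substantial step. Suppose [u] dominates the positive unit ball, and call [e] a component of [u]
    if [e] is disjoint from [u - e]. A nonzero component satisfies [e <= ||e|| u], which is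
    compatible with disjointness only if [||e|| >= 1]. A vector with no proper component spans its
    whole order interval, so in infinite dimension proper components can be split off forever, and
    the remainders decrease by steps of norm at least 1. A weak cluster point of the remainders is a
    lower bound from which they stay uniformly away, and a single functional detects this.

    The bound [2^-(n+2)] makes all increments from stage [j] on add up to [2^-(j+1)] at [|a_j|],
    half of the slack [2^-j] that the norm of [f_j] leaves.

    The weak topology is never introduced: closed convex sets are intersections of half-spaces, and
    compactness is a Hahn-Banach extension on the functions on [X], represented by a point through
    reflexivity. *)

Record rvs := {
  rcar :> Type;
  rzero : rcar;
  radd : rcar -> rcar -> rcar;
  ropp : rcar -> rcar;
  rscal : R -> rcar -> rcar;
  radd_assoc : forall x y z, radd x (radd y z) = radd (radd x y) z;
  radd_comm : forall x y, radd x y = radd y x;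
  radd_0 : forall x, radd x rzero = x;
  radd_opp : forall x, radd x (ropp x) = rzero;
  rscal_1 : forall x, rscal 1 x = x;
  rscal_assoc : forall a b x, rscal a (rscal b x) = rscal (a * b) x;
  rscal_distr_r : forall a x y, rscal a (radd x y) = radd (rscal a x) (rscal a y);
  rscal_distr_l : forall a b x, rscal (a + b) x = radd (rscal a x) (rscal b x)
}.

Definition lattice_rvs (X : BanachLattice) : rvs :=
  {| rcar := X; rzero := vzero X; radd := vadd X; ropp := vopp X;
     rscal := vscal X;
     radd_assoc := vadd_assoc X; radd_comm := vadd_comm X;
     radd_0 := vadd_0 X; radd_opp := vadd_opp X; rscal_1 := vscal_1 X;
     rscal_assoc := vscal_assoc X; rscal_distr_r := vscal_distr_r X;
     rscal_distr_l := vscal_distr_l X |}.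

(** Hahn-Banach is applied both on the lattice and on the dual. The dual is treated as a subset of
    the space of all functions, which avoids a subtype of functionals. *)
Definition fun_rvs (T : Type) : rvs.
Proof.
  refine {| rcar := T -> R; rzero := fun _ => 0;
            radd := fun f g x => f x + g x; ropp := fun f x => - f x;
            rscal := fun a f x => a * f x |};
    intros; apply functional_extensionality; intros; ring.
Defined.

(** * Deciding vector identities by reflection *)

Section NormalForm.
Variable V : rvs.

Lemma rscal_0 (x : V) : rscal V 0 x = rzero V.
Proof.
  assert (E : radd V (rscal V 0 x) (rscal V 0 x) = rscal V 0 x)
    by (rewrite <- rscal_distr_l; f_equal; ring).
  rewrite <- (radd_opp V (rscal V 0 x)), <- E at 1.
  rewrite <- E at 3.
  now rewrite <- radd_assoc, E, radd_opp, radd_0.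
Qed.

Lemma rscal_zero (a : R) : rscal V a (rzero V) = rzero V.
Proof.
  rewrite <- (rscal_0 (rzero V)), rscal_assoc. f_equal. ring.
Qed.

Lemma ropp_scal (x : V) : ropp V x = rscal V (-1) x.
Proof.
  rewrite <- (radd_0 V (ropp V x)), <- (rscal_0 x).
  replace 0 with (1 + -1) by ring.
  rewrite rscal_distr_l, rscal_1, radd_assoc, (radd_comm V (ropp V x)),
    radd_opp, radd_comm.
  apply radd_0.
Qed.

Inductive vexp :=
| VA (n : nat) | V0 | VAdd (a b : vexp) | VOpp (a : vexp) | VScal (r : R) (a : vexp).

Fixpoint veval (env : list V) (e : vexp) : V :=
  match e with
  | VA n => List.nth n env (rzero V)
  | V0 => rzero V
  | VAdd a b => radd V (veval env a) (veval env b)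
  | VOpp a => ropp V (veval env a)
  | VScal r a => rscal V r (veval env a)
  end.

Fixpoint vcoef (e : vexp) (i : nat) : R :=
  match e with
  | VA n => if Nat.eqb n i then 1 else 0
  | V0 => 0
  | VAdd a b => vcoef a i + vcoef b i
  | VOpp a => - vcoef a i
  | VScal r a => r * vcoef a i
  end.

Fixpoint vsum (env : list V) (c : nat -> R) : V :=
  match env with
  | nil => rzero V
  | cons x env' => radd V (rscal V (c O) x) (vsum env' (fun i => c (S i)))
  end.

Lemma vsum_add env : forall c d,
  vsum env (fun i => c i + d i) = radd V (vsum env c) (vsum env d).
Proof.
  induction env as [|x env IH]; intros c d; cbn; [now rewrite radd_0|].
  rewrite (IH (fun i => c (S i)) (fun i => d (S i))), rscal_distr_l.
  rewrite !radd_assoc. f_equal. rewrite <- !radd_assoc. f_equal. apply radd_comm.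
Qed.

Lemma vsum_scal env r : forall c,
  vsum env (fun i => r * c i) = rscal V r (vsum env c).
Proof.
  induction env as [|x env IH]; intros c; cbn; [now rewrite rscal_zero|].
  now rewrite (IH (fun i => c (S i))), rscal_distr_r, rscal_assoc.
Qed.

Lemma vsum_0 env : vsum env (fun _ => 0) = rzero V.
Proof.
  induction env as [|x env IH]; cbn; [easy|]. now rewrite IH, rscal_0, radd_0.
Qed.

Lemma vsum_nth env : forall n,
  vsum env (fun i => if Nat.eqb n i then 1 else 0) = List.nth n env (rzero V).
Proof.
  induction env as [|x env IH]; intros [|n]; cbn; try easy.
  - now rewrite vsum_0, rscal_1, radd_0.
  - now rewrite IH, rscal_0, radd_comm, radd_0.
Qed.

Lemma veval_vsum env e : veval env e = vsum env (vcoef e).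
Proof.
  induction e as [n| |a IHa b IHb|a IHa|r a IHa]; cbn.
  - now rewrite vsum_nth.
  - now rewrite vsum_0.
  - now rewrite vsum_add, IHa, IHb.
  - rewrite ropp_scal, IHa, <- vsum_scal. f_equal.
    apply functional_extensionality; intros; ring.
  - now rewrite vsum_scal, IHa.
Qed.

(** The comparison follows [env], so for a concrete list of atoms it computes to a finite
    conjunction of real equations. *)
Fixpoint coefs_agree (env : list V) (c d : nat -> R) : Prop :=
  match env with
  | nil => True
  | cons _ env' => c O = d O /\ coefs_agree env' (fun i => c (S i)) (fun i => d (S i))
  end.

Lemma vsum_ext env : forall c d, coefs_agree env c d -> vsum env c = vsum env d.
Proof.
  induction env as [|x env IH]; intros c d; cbn; [easy|].
  intros [H1 H2]. now rewrite H1, (IH _ _ H2).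
Qed.

Lemma veval_eq env e1 e2 :
  coefs_agree env (vcoef e1) (vcoef e2) -> veval env e1 = veval env e2.
Proof. rewrite !veval_vsum. apply vsum_ext. Qed.

End NormalForm.

Ltac venv_add x env :=
  let rec aux l :=
    match l with
    | nil => false
    | cons ?y ?l' => match constr:((x, y)) with
                     | (?z, ?z) => true
                     | _ => aux l'
                     end
    end in
  let b := aux env in
  match b with true => env | false => constr:(cons x env) end.

Ltac venv t env :=
  lazymatch t with
  | vadd _ ?a ?b => let e := venv a env in venv b e
  | radd _ ?a ?b => let e := venv a env in venv b e
  | vopp _ ?a => venv a env
  | ropp _ ?a => venv a env
  | vscal _ _ ?a => venv a env
  | rscal _ _ ?a => venv a env
  | vzero _ => env
  | rzero _ => env
  | ?x => venv_add x env
  end.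

Ltac vindex x env :=
  lazymatch env with
  | cons x _ => constr:(O)
  | cons _ ?l => let n := vindex x l in constr:(S n)
  end.

Ltac vreify t env :=
  lazymatch t with
  | vadd _ ?a ?b => let a' := vreify a env in let b' := vreify b env in constr:(VAdd a' b')
  | radd _ ?a ?b => let a' := vreify a env in let b' := vreify b env in constr:(VAdd a' b')
  | vopp _ ?a => let a' := vreify a env in constr:(VOpp a')
  | ropp _ ?a => let a' := vreify a env in constr:(VOpp a')
  | vscal _ ?r ?a => let a' := vreify a env in constr:(VScal r a')
  | rscal _ ?r ?a => let a' := vreify a env in constr:(VScal r a')
  | vzero _ => constr:(V0)
  | rzero _ => constr:(V0)
  | ?x => let n := vindex x env in constr:(VA n)
  end.

Ltac vec_in V a b :=
  let e0 := venv a (@nil (rcar V)) in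
  let env := venv b e0 in
  let ea := vreify a env in
  let eb := vreify b env in
  change (veval V env ea = veval V env eb);
  apply veval_eq; cbn; repeat split; try (solve [ring | lra | field; lra]).

(* Proves identities between linear combinations by comparing coefficients. *)
Ltac vec :=
  intros;
  lazymatch goal with
  | |- @eq ?T ?a ?b =>
      lazymatch T with
      | carrier ?X => vec_in (lattice_rvs X) a b
      | rcar ?V => vec_in V a b
      end
  end.

(** Zorn's lemma above a given member, with only nonempty chains to check. *)
Lemma maximal_set (T : Type) (Q : (T -> Prop) -> Prop) (A0 : T -> Prop) :
  Q A0 ->
  (forall C : (T -> Prop) -> Prop,
     (exists A, C A) -> (forall A, C A -> Q A) ->
     (forall A B, C A -> C B ->
        (forall x, A x -> B x) \/ (forall x, B x -> A x)) ->
     Q (fun x => exists A, C A /\ A x)) ->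
  exists A, Q A /\ (forall x, A0 x -> A x) /\
    forall B, Q B -> (forall x, A x -> B x) -> forall x, B x -> A x.
Proof.
  intros H0 HC.
  pose (Q' := fun A : T -> Prop => (forall x, ~ A x) \/ (Q A /\ forall x, A0 x -> A x)).
  destruct (@classical_sets.Zorn_bigcup T Q') as [A [HA Hmax]].
  - intros C HCQ Htot.
    destruct (classic (exists A, C A /\ exists x, A x)) as [[A1 [HA1 [x1 Hx1]]]|Hno].
    + right.
      pose (C' := fun A : T -> Prop => C A /\ exists x, A x).
      assert (HC' : forall A, C' A -> Q A /\ forall x, A0 x -> A x).
      { intros A [HA [x Hx]]. destruct (HCQ A HA) as [He|H]; [now elim (He x)|easy]. }
      assert (E : classical_sets.bigcup C (fun A => A) = (fun x => exists A, C' A /\ A x)).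
      { apply functional_extensionality; intros x; apply propositional_extensionality; split.
        - intros [A HA Hx]. exists A. split; [split; [easy|now exists x]|easy].
        - intros [A [[HA _] Hx]]. now exists A. }
      rewrite E. split.
      * apply HC.
        -- exists A1. split; [easy|now exists x1].
        -- intros A HA. now apply HC'.
        -- intros A B [HA _] [HB _]. destruct (Htot A B HA HB) as [H|H]; [left|right]; exact H.
      * intros x Hx. exists A1. split; [split; [easy|now exists x1]|].
        apply (HC' A1); [split; [easy|now exists x1]|easy].
    + left. intros x [A HA Hx]. apply Hno. exists A. split; [easy|now exists x].
  - assert (Hlt : forall B : T -> Prop, Q' B -> (forall x, A x -> B x) -> forall x, B x -> A x).
    { intros B HB HAB. apply NNPP; intros Hn. apply (Hmax B); [|exact HB].
      split; [exact HAB|exact Hn]. }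
    destruct HA as [He|[HQ HA]].
    (* If the maximal set is the empty one, every member of [Q] above [A0] is empty, so [A0] is
       itself maximal. *)
    + exists A0. split; [easy|]. split; [easy|].
      intros B HB H0B x Hx. elim (He x). apply (Hlt B); [|intros y Hy; now elim (He y)|easy].
      right. now split.
    + exists A. split; [easy|]. split; [easy|]. intros B HB HAB. apply Hlt; [|easy].
      right. split; [easy|]. auto.
Qed.

Section HahnBanach.
Variable V : rvs.

(** A convex cone in [V * R]. The last clause keeps the fibre over the origin from going below 0, as
    for the epigraph of a finite sublinear function. *)
Definition subcone (P : V -> R -> Prop) : Prop :=
  (forall x y a b, P x a -> P y b -> P (radd V x y) (a + b)) /\
  (forall t x a, 0 < t -> P x a -> P (rscal V t x) (t * a)) /\
  (forall a, P (rzero V) a -> 0 <= a).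

(* Hahn-Banach for epigraphs: [P] plays the role of {(x,a) | p x <= a} for a
   sublinear [p] defined on [D]; a maximal cone of this kind is an epigraph of
   a linear functional. *)
Lemma hahn_banach (P : V -> R -> Prop) (D : V -> Prop) :
  subcone P ->
  (forall x, D x -> exists a, P x a) ->
  (forall x, D x -> D (ropp V x)) ->
  exists f : V -> R,
    (forall x y, D x -> D y -> f (radd V x y) = f x + f y) /\
    (forall t x, D x -> f (rscal V t x) = t * f x) /\
    (forall x a, D x -> P x a -> f x <= a).
Proof.
  intros HP HD HDo.
  destruct (@maximal_set (V * R) (fun A => subcone (fun x a => A (x, a)))
              (fun z => P (fst z) (snd z))) as [A [HA [HPA Hmax]]].
  - exact HP.
  - intros C [A1 HA1] HCQ Htot. split; [|split].
    + intros x y a b [A [HA Ha]] [B [HB Hb]].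
      destruct (Htot A B HA HB) as [H|H].
      * exists B. split; [easy|]. apply (HCQ B HB); auto.
      * exists A. split; [easy|]. apply (HCQ A HA); auto.
    + intros t x a Ht [A [HA Ha]]. exists A. split; [easy|]. now apply (HCQ A HA).
    + intros a [A [HA Ha]]. now apply (HCQ A HA).
  - destruct HA as [Aadd [Ascal A0]].
    pose (Aext := fun (x : V) (r : R) (z : V * R) => exists t y a, 0 <= t /\ A (y, a) /\
        z = (radd V y (rscal V t x), a + t * r)).
    (* [Aext x r] is the cone generated by [A] and [(x, r)]. A positive multiple of [(x, r)] lands
       over the origin only together with a rescaled point of [A] over [-x], so the condition on [b]
       is what keeps the third clause. Maximality then puts [(x, r)] into [A]. *)
    assert (Hext : forall x r, (exists y a, A (y, a)) ->
              (forall b, A (ropp V x, b) -> 0 <= b + r) -> A (x, r)).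
    { intros x r [y0 [a0 Hy0]] Hr.
      assert (HQ : subcone (fun z a => Aext x r (z, a))).
      { split; [|split].
        - intros z z' a b [t [y [c [Ht [Hy E]]]]] [t' [y' [c' [Ht' [Hy' E']]]]].
          injection E; injection E'; intros; subst.
          exists (t + t'), (radd V y y'), (c + c'). split; [lra|]. split; [now apply Aadd|].
          f_equal; [vec|ring].
        - intros s z a Hs [t [y [c [Ht [Hy E]]]]]. injection E; intros; subst.
          exists (s * t), (rscal V s y), (s * c).
          split; [apply Rmult_le_pos; lra|]. split; [now apply Ascal|].
          f_equal; [vec|ring].
        - intros a [t [y [c [Ht [Hy E]]]]]. injection E; intros Ea Ez.
          destruct Ht as [Ht|Ht].
          + assert (Hy' : A (rscal V (/ t) y, / t * c))
              by (apply Ascal; [now apply Rinv_0_lt_compat|easy]).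
            replace (rscal V (/ t) y) with (ropp V x) in Hy'.
            * apply Hr in Hy'. replace a with (t * (/ t * c + r)) by (subst; field; lra).
              apply Rmult_le_pos; lra.
            * transitivity (rscal V (/ t) (radd V (radd V y (rscal V t x)) (rscal V (- t) x))).
              -- rewrite <- Ez. vec.
              -- vec.
          + subst t. rewrite Ea, Rmult_0_l, Rplus_0_r. apply A0.
            rewrite Ez. replace (radd V y (rscal V 0 x)) with y by vec. exact Hy. }
      assert (HAext : forall z, A z -> Aext x r z).
      { intros [y a] H. exists 0, y, a. split; [lra|]. split; [easy|]. f_equal; [vec|ring]. }
      assert (H00 : A (rzero V, 0)).
      { apply (Hmax (fun z => A z \/ z = (rzero V, 0))); [|auto|auto].
        split; [|split].
        - intros z z' a b [H|H] [H'|H'].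
          + left; now apply Aadd.
          + injection H'; intros; subst. left. rewrite radd_0, Rplus_0_r. exact H.
          + injection H; intros; subst. left. rewrite radd_comm, radd_0, Rplus_0_l. exact H'.
          + injection H; injection H'; intros; subst. right. f_equal; [vec|ring].
        - intros s z a Hs [H|H]; [left; now apply Ascal|].
          injection H; intros; subst. right. f_equal; [vec|ring].
        - intros a [H|H]; [now apply A0|]. injection H; intros; lra. }
      apply (Hmax (Aext x r)); [exact HQ|exact HAext|].
      exists 1, (rzero V), 0. split; [lra|]. split; [easy|]. f_equal; [vec|ring]. }
    (* Here [r] is the infimum of the fibre of [A] over [x]. It is finite because points over [x]
       and [-x] add up to points over the origin, and [Hext] shows that it is attained on both
       sides. *)
    assert (Hr : forall x, D x -> exists r, A (x, r) /\ A (ropp V x, - r)).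
    { intros x Hx. destruct (HD x Hx) as [a0 Ha0]. destruct (HD _ (HDo x Hx)) as [b0 Hb0].
      pose proof (HPA (_, _) Hb0) as Hb0'. pose proof (HPA (_, _) Ha0) as Ha0'.
      assert (Hlow : forall a b, A (x, a) -> A (ropp V x, b) -> - b <= a).
      { intros a b Ha Hb. assert (0 <= a + b); [|lra]. apply A0.
        rewrite <- (radd_opp V x). now apply Aadd. }
      destruct (completeness (fun m => A (x, - m))) as [m [Hub Hlub]].
      - exists b0. intros m Hm. apply (Hlow _ _ Hm) in Hb0'. lra.
      - exists (- a0). now rewrite Ropp_involutive.
      - exists (- m).
        assert (H2 : A (ropp V x, - - m)).
        { apply Hext; [now exists x, a0|]. intros b Hb.
          replace (ropp V (ropp V x)) with x in Hb by vec.
          assert (- b <= m); [|lra]. apply Hub. now rewrite Ropp_involutive. }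
        split; [|exact H2].
        apply Hext; [now exists x, a0|]. intros b Hb.
        assert (m <= b); [|lra]. apply Hlub. intros c Hc.
        pose proof (Hlow _ _ Hc Hb). lra. }
    (* A total function is needed; it is 0 at vectors where no such [r] exists. *)
    assert (Hf : exists f : V -> R, forall x, (exists r, A (x, r) /\ A (ropp V x, - r)) ->
               A (x, f x) /\ A (ropp V x, - f x)).
    { assert (Hx : forall x, exists r, (exists r', A (x, r') /\ A (ropp V x, - r')) ->
                 A (x, r) /\ A (ropp V x, - r)).
      { intros x. destruct (classic (exists r, A (x, r) /\ A (ropp V x, - r))) as [[r H]|H];
          [now exists r|now exists 0]. }
      exists (fun x => proj1_sig (constructive_indefinite_description _ (Hx x))).
      intros x. exact (proj2_sig (constructive_indefinite_description _ (Hx x))). }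
    destruct Hf as [f Hf].
    assert (Huniq : forall x r, A (x, r) -> A (ropp V x, - r) -> f x = r).
    { intros x r H1 H2. destruct (Hf x) as [H3 H4]; [now exists r|].
      assert (0 <= r + - f x) by (apply A0; rewrite <- (radd_opp V x); now apply Aadd).
      assert (0 <= f x + - r) by (apply A0; rewrite <- (radd_opp V x); now apply Aadd).
      lra. }
    exists f. split; [|split].
    + intros x y Hx Hy. destruct (Hf x (Hr x Hx)) as [H1 H2]. destruct (Hf y (Hr y Hy)) as [H3 H4].
      apply Huniq; [now apply Aadd|].
      replace (ropp V (radd V x y)) with (radd V (ropp V x) (ropp V y)) by vec.
      replace (- (f x + f y)) with (- f x + - f y) by ring. now apply Aadd.
    + intros t x Hx. destruct (Hf x (Hr x Hx)) as [H1 H2].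
      destruct (Rtotal_order t 0) as [Ht|[Ht|Ht]].
      * apply Huniq.
        -- replace (rscal V t x) with (rscal V (- t) (ropp V x)) by vec.
           replace (t * f x) with (- t * - f x) by ring. apply Ascal; [lra|easy].
        -- replace (ropp V (rscal V t x)) with (rscal V (- t) x) by vec.
           replace (- (t * f x)) with (- t * f x) by ring. apply Ascal; [lra|easy].
      * subst t. apply Huniq.
        -- replace (rscal V 0 x) with (radd V x (ropp V x)) by vec.
           replace (0 * f x) with (f x + - f x) by ring. now apply Aadd.
        -- replace (ropp V (rscal V 0 x)) with (radd V x (ropp V x)) by vec.
           replace (- (0 * f x)) with (f x + - f x) by ring. now apply Aadd.
      * apply Huniq; [now apply Ascal|].
        replace (ropp V (rscal V t x)) with (rscal V t (ropp V x)) by vec.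
        replace (- (t * f x)) with (t * - f x) by ring. now apply Ascal.
    + intros x a Hx HPx. destruct (Hf x (Hr x Hx)) as [H1 H2].
      assert (0 <= a + - f x); [|lra]. apply A0. rewrite <- (radd_opp V x).
      apply Aadd; [now apply HPA|easy].
Qed.

End HahnBanach.

(** * Positive functionals on a Banach lattice and weak compactness *)

Definition vpos (X : BanachLattice) (x : X) : X := vjoin X x (vzero X).
Definition vabs (X : BanachLattice) (x : X) : X := vjoin X x (vopp X x).
Definition vmeet (X : BanachLattice) (x y : X) : X :=
  vopp X (vjoin X (vopp X x) (vopp X y)).

Definition positive_dual (X : BanachLattice) (f : X -> R) : Prop :=
  is_dual_elt X f /\ forall x, vle X (vzero X) x -> 0 <= f x.

Section Lattice.
Variable X : BanachLattice.
Notation "0v" := (vzero X).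
Infix "+v" := (vadd X) (at level 50, left associativity).
Infix "*v" := (vscal X) (at level 40, left associativity).
Infix "<=v" := (vle X) (at level 70).

Lemma vle_add2 (x y z w : X) : x <=v y -> z <=v w -> x +v z <=v y +v w.
Proof.
  intros H1 H2. apply vle_trans with (y +v z); [now apply vle_add|].
  rewrite (vadd_comm X y z), (vadd_comm X y w). now apply vle_add.
Qed.

Lemma vle_sub (x y : X) : 0v <=v vadd X y (vopp X x) -> x <=v y.
Proof.
  intros H. apply (vle_add X _ _ x) in H.
  replace (0v +v x) with x in H by vec.
  now replace (y +v vopp X x +v x) with y in H by vec.
Qed.

Lemma vle_opp (x y : X) : x <=v y -> vopp X y <=v vopp X x.
Proof.
  intros H. apply vle_sub. apply (vle_add X _ _ (vopp X x)) in H.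
  rewrite vadd_opp in H. now replace (vopp X x +v vopp X (vopp X y)) with (y +v vopp X x) by vec.
Qed.

Lemma vpos_ge (x : X) : x <=v vpos X x. Proof. apply vjoin_l. Qed.
Lemma vpos_ge0 (x : X) : 0v <=v vpos X x. Proof. apply vjoin_r. Qed.

Lemma vpos_mono (x y : X) : x <=v y -> vpos X x <=v vpos X y.
Proof.
  intros H. apply vjoin_lub; [|apply vpos_ge0].
  apply vle_trans with y; [easy|apply vpos_ge].
Qed.

Lemma vpos_add (x y : X) : vpos X (x +v y) <=v vpos X x +v vpos X y.
Proof.
  apply vjoin_lub.
  - apply vle_add2; apply vpos_ge.
  - rewrite <- (vadd_0 X 0v). apply vle_add2; apply vpos_ge0.
Qed.

Lemma vpos_scal (t : R) (x : X) : 0 <= t -> vpos X (t *v x) <=v t *v vpos X x.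
Proof.
  intros Ht. apply vjoin_lub.
  - apply vle_scal; [easy|apply vpos_ge].
  - replace 0v with (t *v 0v) by vec. apply vle_scal; [easy|apply vpos_ge0].
Qed.

Lemma vpos_of_ge0 (x : X) : 0v <=v x -> vpos X x = x.
Proof.
  intros H. apply vle_antisym; [|apply vpos_ge].
  apply vjoin_lub; [apply vle_refl|easy].
Qed.

Lemma vpos_of_le0 (x : X) : x <=v 0v -> vpos X x = 0v.
Proof.
  intros H. apply vle_antisym; [|apply vpos_ge0].
  apply vjoin_lub; [easy|apply vle_refl].
Qed.

Lemma vabs_of_ge0 (x : X) : 0v <=v x -> vabs X x = x.
Proof.
  intros H. apply vle_antisym; [|apply vjoin_l].
  apply vjoin_lub; [apply vle_refl|]. apply vle_trans with 0v; [|easy].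
  replace 0v with (vopp X 0v) by vec. now apply vle_opp.
Qed.

Lemma vabs_ge0 (x : X) : 0v <=v vabs X x.
Proof.
  replace 0v with ((/ 2) *v (x +v vopp X x)) by vec.
  replace (vabs X x) with ((/ 2) *v (vabs X x +v vabs X x)) by vec.
  apply vle_scal; [lra|]. apply vle_add2; [apply vjoin_l|apply vjoin_r].
Qed.

Lemma vnorm_mono (x y : X) : 0v <=v x -> x <=v y -> vnorm X x <= vnorm X y.
Proof.
  intros Hx Hxy. apply vnorm_lattice. fold (vabs X x) (vabs X y).
  rewrite !vabs_of_ge0; [easy| |easy]. now apply vle_trans with x.
Qed.

Lemma vnorm_0 : vnorm X 0v = 0.
Proof.
  replace 0v with (0 *v 0v) by vec. rewrite vnorm_scal, Rabs_R0. ring.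
Qed.

Lemma vnorm_abs (x : X) : vnorm X (vabs X x) <= vnorm X x.
Proof.
  apply vnorm_lattice. fold (vabs X x) (vabs X (vabs X x)).
  rewrite vabs_of_ge0; [apply vle_refl|apply vabs_ge0].
Qed.

Lemma vnorm_vpos (x : X) : vnorm X (vpos X x) <= vnorm X x.
Proof.
  apply Rle_trans with (vnorm X (vabs X x)); [|apply vnorm_abs].
  apply vnorm_mono; [apply vpos_ge0|].
  apply vjoin_lub; [apply vjoin_l|apply vabs_ge0].
Qed.

Lemma vnorm_vpos_scal (t : R) (x : X) :
  0 <= t -> vnorm X (vpos X (t *v x)) <= t * vnorm X (vpos X x).
Proof.
  intros Ht. rewrite <- (Rabs_pos_eq t) at 2 by easy. rewrite <- vnorm_scal.
  apply vnorm_mono; [apply vpos_ge0|now apply vpos_scal].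
Qed.

Lemma vnorm_vpos_le_add (x y z : X) :
  z <=v x +v y -> vnorm X (vpos X z) <= vnorm X (vpos X x) + vnorm X (vpos X y).
Proof.
  intros H. eapply Rle_trans; [|apply vnorm_triangle].
  apply vnorm_mono; [apply vpos_ge0|].
  apply vle_trans with (vpos X (x +v y)); [now apply vpos_mono|apply vpos_add].
Qed.

(* Mazur's theorem for downward directed sets. *)
Lemma positive_functional_above (S : X -> Prop) (delta : R) :
  (exists y, S y) ->
  (forall y y', S y -> S y' -> exists z, S z /\ z <=v y /\ z <=v y') ->
  (forall y, S y -> delta <= vnorm X (vpos X y)) ->
  exists f, positive_dual X f /\ (forall x, f x <= vnorm X (vpos X x)) /\
    forall y, S y -> delta <= f y.
Proof.
  intros [y0 Hy0] Hdir Hdelta.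
  (* Epigraph of [p x = inf (||(x + t y)^+|| - t delta)] over [t >= 0] and [y] in [S]. For a linear
     [f <= p], the choice [t = 0] gives positivity and the norm bound, and [t = 1] at [x = -y] gives
     [delta <= f y]. *)
  pose (P := fun (x : X) (a : R) =>
    exists t y, 0 <= t /\ S y /\ vnorm X (vpos X (x +v t *v y)) <= a + t * delta).
  destruct (@hahn_banach (lattice_rvs X) P (fun _ => True)) as [f [Hadd [Hscal HP]]].
  - split; [|split]; cbn.
    + intros x x' a a' [t [y [Ht [Hy H]]]] [t' [y' [Ht' [Hy' H']]]].
      (* A common lower bound replaces the convex combination of [y] and [y'] here, since [||x^+||]
         is monotone. *)
      destruct (Hdir y y' Hy Hy') as [z [Hz [Hzy Hzy']]].
      exists (t + t'), z. split; [lra|]. split; [easy|].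
      eapply Rle_trans; [apply (vnorm_vpos_le_add (x +v t *v y) (x' +v t' *v y'))|lra].
      replace (x +v x' +v (t + t') *v z) with ((x +v x') +v (t *v z +v t' *v z)) by vec.
      replace (x +v t *v y +v (x' +v t' *v y')) with ((x +v x') +v (t *v y +v t' *v y')) by vec.
      apply vle_add2; [apply vle_refl|]. apply vle_add2; now apply vle_scal.
    + intros s x a Hs [t [y [Ht [Hy H]]]].
      exists (s * t), y. split; [apply Rmult_le_pos; lra|]. split; [easy|].
      replace (s *v x +v (s * t) *v y) with (s *v (x +v t *v y)) by vec.
      eapply Rle_trans; [apply vnorm_vpos_scal; lra|].
      replace (s * a + s * t * delta) with (s * (a + t * delta)) by ring.
      apply Rmult_le_compat_l; lra.
    + intros a [t [y [Ht [Hy H]]]].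
      replace (0v +v t *v y) with (t *v y) in H by vec.
      destruct Ht as [Ht|Ht].
      * pose proof (vnorm_vpos_scal (/ t) (t *v y)) as H1.
        replace (/ t *v (t *v y)) with y in H1 by vec.
        assert (Hit : 0 < / t) by now apply Rinv_0_lt_compat.
        specialize (H1 ltac:(lra)). pose proof (Hdelta y Hy) as H2.
        assert (t * delta <= t * (/ t * vnorm X (vpos X (t *v y))))
          by (apply Rmult_le_compat_l; lra).
        replace (t * (/ t * vnorm X (vpos X (t *v y)))) with (vnorm X (vpos X (t *v y))) in H0
          by (field; lra). lra.
      * subst t. pose proof (vnorm_nonneg X (vpos X (0 *v y))). lra.
  - intros x _. exists (vnorm X (vpos X (x +v 0 *v y0))). exists 0, y0.
    split; [lra|]. split; [easy|]. lra.
  - easy.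
  - cbn in Hadd, Hscal.
    assert (Hfle : forall x, f x <= vnorm X (vpos X x)).
    { intros x. apply HP; [easy|]. exists 0, y0. split; [lra|]. split; [easy|].
      replace (x +v 0 *v y0) with x by vec. lra. }
    assert (Hopp : forall x, f (vopp X x) = - f x).
    { intros x. replace (vopp X x) with ((-1) *v x) by vec. rewrite Hscal; [ring|easy]. }
    exists f. split; [|split; [easy|]].
    + split; [split; [|split]|].
      * intros; now apply Hadd.
      * intros; now apply Hscal.
      * exists 1. intros x. apply Rabs_le. rewrite Rmult_1_l. split.
        -- pose proof (Hfle (vopp X x)) as H. rewrite Hopp in H.
           pose proof (vnorm_vpos (vopp X x)) as H1.
           replace (vopp X x) with ((-1) *v x) in H1 at 2 by vec.
           rewrite vnorm_scal, (Rabs_left (-1)) in H1 by lra. lra.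
        -- pose proof (Hfle x). pose proof (vnorm_vpos x). lra.
      * intros x Hx. pose proof (Hfle (vopp X x)) as H.
        rewrite Hopp, vpos_of_le0, vnorm_0 in H; [lra|].
        replace 0v with (vopp X 0v) by vec. now apply vle_opp.
    + intros y Hy. assert (f (vopp X y) <= - delta); [|rewrite Hopp in *; lra].
      apply HP; [easy|]. exists 1, y. split; [lra|]. split; [easy|].
      replace (vopp X y +v 1 *v y) with 0v by vec.
      rewrite vpos_of_ge0, vnorm_0; [lra|apply vle_refl].
Qed.

Lemma vle_of_vpos_eq0 (x y : X) : vnorm X (vpos X (vadd X x (vopp X y))) = 0 -> x <=v y.
Proof.
  intros H. apply vnorm_eq0 in H. pose proof (vpos_ge (x +v vopp X y)) as H1.
  rewrite H in H1. apply (vle_add X _ _ y) in H1.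
  replace (0v +v y) with y in H1 by vec. now replace (x +v vopp X y +v y) with x in H1 by vec.
Qed.

(** A supporting functional of [||x^+||] at [z], obtained from the directed set [{z}]. *)
Lemma positive_functional_at (z : X) :
  exists f, positive_dual X f /\ (forall x, f x <= vnorm X (vpos X x)) /\
    f z = vnorm X (vpos X z).
Proof.
  destruct (positive_functional_above (fun y => y = z) (vnorm X (vpos X z)))
    as [f [Hf [Hle Hge]]].
  - now exists z.
  - intros y y' -> ->. exists z. split; [easy|]. split; apply vle_refl.
  - intros y ->. lra.
  - exists f. split; [easy|]. split; [easy|]. apply Rle_antisym; auto.
Qed.

(** A functional with value [||(x - y)^+||] at [x - y] is nonpositive there only if this norm is 0.
    Order inequalities thereby reduce to inequalities between reals. *)
Lemma vle_of_dual (x y : X) : (forall f, positive_dual X f -> f x <= f y) -> x <=v y.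
Proof.
  intros H. apply vle_of_vpos_eq0.
  destruct (positive_functional_at (x +v vopp X y)) as [f [Hf [_ E]]].
  pose proof (vnorm_nonneg X (vpos X (x +v vopp X y))) as H0.
  specialize (H f Hf). destruct Hf as [[Hadd [Hscal _]] _].
  replace (x +v vopp X y) with (x +v (-1) *v y) in E at 1 by vec.
  rewrite Hadd, Hscal in E. lra.
Qed.

Section PositiveDual.
Variable f : X -> R.
Hypothesis Hf : positive_dual X f.

Lemma pd_add x y : f (x +v y) = f x + f y. Proof. apply Hf. Qed.
Lemma pd_scal t x : f (t *v x) = t * f x. Proof. apply Hf. Qed.
Lemma pd_opp x : f (vopp X x) = - f x.
Proof. replace (vopp X x) with ((-1) *v x) by vec. rewrite pd_scal. ring. Qed.
Lemma pd_0 : f 0v = 0.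
Proof. replace 0v with (0 *v 0v) by vec. rewrite pd_scal. ring. Qed.
Lemma pd_mono x y : x <=v y -> f x <= f y.
Proof.
  intros H. apply (vle_add X _ _ (vopp X x)) in H. rewrite vadd_opp in H.
  apply (proj2 Hf) in H. rewrite pd_add, pd_opp in H. lra.
Qed.
End PositiveDual.

End Lattice.

(* Derives a vector inequality from the inequalities in the context by testing
   it on positive functionals, where it becomes linear real arithmetic. *)
Ltac dual_le :=
  intros; apply vle_of_dual;
  let f := fresh "f" in let Hf := fresh "Hf" in
  intros f Hf;
  repeat match goal with
  | H : vle _ ?a ?b |- _ => generalize (pd_mono _ f Hf a b H); clear H
  end;
  rewrite ?(pd_0 _ f Hf);
  repeat first [rewrite (pd_add _ f Hf) | rewrite (pd_scal _ f Hf)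
               | rewrite (pd_opp _ f Hf)];
  rewrite ?(pd_0 _ f Hf);
  intros; first [lra | nra].

(** * Weak compactness of balls from reflexivity *)

Section WeakCompactness.
Variable X : BanachLattice.
Hypothesis Hrefl : reflexive X.
Hypothesis Hnt : exists x : X, 0 < vnorm X x.

(* Weak compactness of balls: the point [x] lies in the weakly closed convex
   hull of every member of the filter base. *)
Lemma weak_cluster (Fam : (X -> Prop) -> Prop) (M : R) :
  (exists F, Fam F) ->
  (forall F, Fam F -> exists y, F y) ->
  (forall F G, Fam F -> Fam G -> exists H, Fam H /\ forall y, H y -> F y /\ G y) ->
  (forall F y, Fam F -> F y -> vnorm X y <= M) ->
  exists x, forall f F c, is_dual_elt X f -> Fam F -> (forall y, F y -> f y <= c) -> f x <= c.
Proof.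
  intros [F0 HF0] Hne Hdir HM.
  (* Epigraph of [h |-> inf_F sup_F h], an upper limit along the filter. A linear functional below
     it on the dual is a generalized limit, bounded by [M], and reflexivity represents it by a
     point. *)
  pose (P := fun (h : X -> R) (a : R) => exists F, Fam F /\ forall y, F y -> h y <= a).
  assert (HPb : forall f m, is_dual_elt X f -> (forall x, Rabs (f x) <= m * vnorm X x) ->
            P f (M * m)).
  { intros f m Hf Hm. exists F0. split; [easy|]. intros y Hy.
    apply Rle_trans with (m * vnorm X y).
    - eapply Rle_trans; [apply Rle_abs|apply Hm].
    - rewrite (Rmult_comm M). apply Rmult_le_compat_l; [|now apply (HM F0)].
      (* A nonzero vector forces [m >= 0]; on the zero space a negative [m] would satisfy the bound
         as well. *)
      destruct Hnt as [x Hx]. pose proof (Hm x). pose proof (Rabs_pos (f x)).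
      apply Rnot_lt_le; intros Hlt. nra. }
  assert (Hscal_dual : forall t f, is_dual_elt X f -> is_dual_elt X (fun x => t * f x)).
  { intros t f [Ha [Hs [m Hm]]]. split; [|split].
    - intros; rewrite Ha; ring.
    - intros; rewrite Hs; ring.
    - exists (Rabs t * m). intros x. rewrite Rabs_mult, Rmult_assoc.
      apply Rmult_le_compat_l; [apply Rabs_pos|apply Hm]. }
  destruct (@hahn_banach (fun_rvs X) P (is_dual_elt X)) as [phi [Hadd [Hscal HP]]].
  - split; [|split]; cbn.
    + intros h k a b [F [HF Ha]] [G [HG Hb]].
      destruct (Hdir F G HF HG) as [H [HH HHy]]. exists H. split; [easy|].
      intros y Hy. destruct (HHy y Hy) as [HFy HGy].
      specialize (Ha y HFy). specialize (Hb y HGy). lra.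
    + intros t h a Ht [F [HF Ha]]. exists F. split; [easy|]. intros y Hy.
      apply Rmult_le_compat_l; [lra|auto].
    + intros a [F [HF Ha]]. destruct (Hne F HF) as [y Hy]. now apply (Ha y).
  - intros f Hf. destruct (Hf) as [_ [_ [m Hm]]]. exists (M * m). now apply HPb.
  - intros f Hf. cbn. apply (Hscal_dual (-1)) in Hf.
    replace (fun x => - f x) with (fun x => -1 * f x); [easy|].
    apply functional_extensionality; intros; ring.
  - destruct (Hrefl phi) as [x Hx].
    + split; [|split].
      * intros f g Hf Hg. now apply Hadd.
      * intros a f Hf. now apply Hscal.
      * exists M. intros f m Hf Hm. apply Rabs_le. split.
        -- assert (phi (fun x => -1 * f x) <= M * m).
           { apply HP; [now apply Hscal_dual|]. apply HPb; [now apply Hscal_dual|].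
             intros x. rewrite Rabs_mult, (Rabs_left (-1)) by lra.
             specialize (Hm x). lra. }
           pose proof (Hscal (-1) f Hf) as E. cbn in E. rewrite E in H. lra.
        -- apply HP; [easy|]. now apply HPb.
    + exists x. intros f F c Hf HF Hc. rewrite <- Hx by easy.
      apply HP; [easy|]. now exists F.
Qed.

Lemma dual_opp (f : X -> R) : is_dual_elt X f -> is_dual_elt X (fun x => - f x).
Proof.
  intros [Ha [Hs [m Hm]]]. split; [|split].
  - intros; rewrite Ha; ring.
  - intros; rewrite Hs; ring.
  - exists m. intros x. rewrite Rabs_Ropp. apply Hm.
Qed.

(** The filter base consists of the tails of [s]. Lower bounds come from applying the upper bounds
    to [-f]. *)
Lemma weak_cluster_seq (s : nat -> X) (M : R) :
  (forall n, vnorm X (s n) <= M) ->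
  exists x, forall f, is_dual_elt X f -> forall n c,
    ((forall m, (n <= m)%nat -> f (s m) <= c) -> f x <= c) /\
    ((forall m, (n <= m)%nat -> c <= f (s m)) -> c <= f x).
Proof.
  intros HM.
  destruct (weak_cluster
    (fun F => exists n, F = fun y => exists m, (n <= m)%nat /\ y = s m) M) as [x Hx].
  - now exists (fun y => exists m, (0 <= m)%nat /\ y = s m), O.
  - intros F [n ->]. exists (s n), n. split; [lia|easy].
  - intros F G [n ->] [m ->].
    exists (fun y => exists k, (Nat.max n m <= k)%nat /\ y = s k).
    split; [now exists (Nat.max n m)|].
    intros y [k [Hk ->]]. split; exists k; split; try easy; lia.
  - intros F y [n ->] [m [_ ->]]. apply HM.
  - exists x.
    assert (H : forall f, is_dual_elt X f -> forall n c,
               (forall m, (n <= m)%nat -> f (s m) <= c) -> f x <= c).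
    { intros f Hf n c Hc.
      apply (Hx f (fun y => exists m, (n <= m)%nat /\ y = s m)); [easy|now exists n|].
      intros y [m [Hm ->]]. auto. }
    intros f Hf n c. split; [now apply H|]. intros Hc.
    assert (- f x <= - c); [|lra].
    apply (H (fun x => - f x) (dual_opp f Hf) n). intros m Hm. specialize (Hc m Hm). lra.
Qed.

End WeakCompactness.

(** * Order faces *)

Section Faces.
Variable X : BanachLattice.
Hypothesis Hrefl : reflexive X.
Hypothesis Hnt : exists x : X, 0 < vnorm X x.

Definition pos_ball (x : X) : Prop := vle X (vzero X) x /\ vnorm X x <= 1.

(** The intersection of all closed half-spaces containing [F], in the form in which [weak_cluster]
    locates its point. *)
Definition weakly_closed_convex (F : X -> Prop) : Prop :=
  forall x, (forall h c, is_dual_elt X h -> (forall y, F y -> h y <= c) -> h x <= c) -> F x.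

(** With an inequality in place of the usual equation, a face is also upward closed in [pos_ball]:
    take [x0 = x1] above [a]. *)
Definition order_face (F : X -> Prop) : Prop :=
  (exists x, F x) /\ (forall x, F x -> pos_ball x) /\ weakly_closed_convex F /\
  forall a x0 x1 t, F a -> pos_ball x0 -> pos_ball x1 -> 0 < t < 1 ->
    vle X a (vadd X (vscal X (1 - t) x0) (vscal X t x1)) -> F x0 /\ F x1.

(** The half-spaces are those of [-f] for positive [f], and that of one functional bounded by 1 on
    the ball whose value at [x] is [||x||]. *)
Lemma pos_ball_wcc : weakly_closed_convex pos_ball.
Proof.
  intros x Hx.
  assert (Hx0 : vle X (vzero X) x).
  { apply vle_of_dual. intros f Hf. rewrite pd_0 by easy.
    assert (- f x <= 0); [|lra].
    apply (Hx (fun y => - f y)); [apply dual_opp, Hf|].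
    intros y [Hy _]. apply (proj2 Hf) in Hy. lra. }
  split; [easy|].
  destruct (positive_functional_at X x) as [f [Hf [Hle E]]].
  rewrite vpos_of_ge0 in E by easy. rewrite <- E.
  apply Hx; [apply Hf|]. intros y [_ Hy].
  pose proof (Hle y). pose proof (vnorm_vpos X y). lra.
Qed.

Lemma pos_ball_0 : pos_ball (vzero X).
Proof. split; [apply vle_refl|]. rewrite vnorm_0. lra. Qed.

Lemma pos_ball_face : order_face pos_ball.
Proof.
  split; [exists (vzero X); apply pos_ball_0|]. split; [easy|].
  split; [apply pos_ball_wcc|easy].
Qed.

(** The maximum is attained because the parts of [F] where [g] exceeds some [c] below the supremum
    form a filter base. The face property survives since [g a <= (1 - t) g u + t g v] with
    [g u, g v <= g a] forces equality. *)
Lemma order_face_argmax (F : X -> Prop) (g : X -> R) :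
  order_face F -> positive_dual X g ->
  order_face (fun x => F x /\ forall y, F y -> g y <= g x).
Proof.
  intros [[x0 Hx0] [HFB [HFw HFf]]] Hg. split; [|split; [|split]].
  - destruct (completeness (fun r => exists y, F y /\ r = g y)) as [m [Hub Hlub]].
    + destruct Hg as [[_ [_ [M HM]]] _]. exists (Rabs M). intros r [y [Hy ->]].
      pose proof (HM y). pose proof (Rle_abs (g y)). destruct (HFB y Hy) as [_ Hy1].
      pose proof (vnorm_nonneg X y). pose proof (Rle_abs M). pose proof (Rabs_pos M). nra.
    + now exists (g x0), x0.
    + assert (Hm : forall c, c < m -> exists y, F y /\ c < g y).
      { intros c Hc. apply NNPP; intros Hn. apply (Rlt_not_le _ _ Hc), Hlub.
        intros r [y [Hy ->]]. apply Rnot_lt_le; intros H. apply Hn. now exists y. }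
      destruct (weak_cluster X Hrefl Hnt
        (fun G => exists c, c < m /\ G = fun y => F y /\ c < g y) 1) as [x Hx].
      * exists (fun y => F y /\ m - 1 < g y), (m - 1). split; [lra|easy].
      * intros G [c [Hc ->]]. now apply Hm.
      * intros G1 G2 [c1 [Hc1 ->]] [c2 [Hc2 ->]].
        exists (fun y => F y /\ Rmax c1 c2 < g y). split.
        -- exists (Rmax c1 c2). split; [now apply Rmax_lub_lt|easy].
        -- intros y [Hy H]. pose proof (Rmax_l c1 c2). pose proof (Rmax_r c1 c2).
           repeat split; try easy; lra.
      * intros G y [c [Hc ->]] [Hy _]. now apply HFB.
      * exists x. split.
        -- apply HFw. intros h c Hh Hc.
           apply (Hx h (fun y => F y /\ m - 1 < g y)); [easy| |].
           ++ exists (m - 1). split; [lra|easy].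
           ++ intros y [Hy _]. auto.
        -- assert (Hmx : m <= g x).
           { apply Rnot_lt_le; intros Hlt.
             assert (- g x <= - ((g x + m) / 2)); [|lra].
             apply (Hx (fun y => - g y) (fun y => F y /\ (g x + m) / 2 < g y)).
             - apply dual_opp, Hg.
             - exists ((g x + m) / 2). split; [lra|easy].
             - intros y [_ Hy]. lra. }
           intros y Hy. apply Rle_trans with m; [|easy]. apply Hub. now exists y.
  - intros x [Hx _]. auto.
  - intros x Hx.
    assert (HFx : F x).
    { apply HFw. intros h c Hh Hc. apply Hx; [easy|]. intros y [Hy _]. auto. }
    split; [easy|]. intros y Hy.
    assert (- g x <= - g y); [|lra].
    apply (Hx (fun y => - g y)); [apply dual_opp, Hg|].
    intros z [_ Hz]. specialize (Hz y Hy). lra.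
  - intros a u v t [Ha Hmax] Hu Hv Ht Hle.
    destruct (HFf a u v t Ha Hu Hv Ht Hle) as [HFu HFv].
    apply (pd_mono X g Hg) in Hle.
    rewrite (pd_add X g Hg), !(pd_scal X g Hg) in Hle.
    pose proof (Hmax u HFu). pose proof (Hmax v HFv).
    assert (g u = g a) by nra. assert (g v = g a) by nra.
    split; (split; [easy|]); intros y Hy; specialize (Hmax y Hy); lra.
Qed.

(** [maximal_set] enlarges sets, so it is applied to complements of faces. Weak compactness keeps
    the intersection of a chain of faces nonempty. *)
Lemma minimal_order_face (F0 : X -> Prop) :
  order_face F0 ->
  exists F, order_face F /\ (forall x, F x -> F0 x) /\
    forall G, order_face G -> (forall x, G x -> F x) -> forall x, F x -> G x.
Proof.
  intros HF0.
  assert (Hcc : forall G : X -> Prop, (fun x => ~ ~ G x) = G).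
  { intros G. apply functional_extensionality; intros x; apply propositional_extensionality.
    split; [apply NNPP|tauto]. }
  destruct (maximal_set X (fun A => order_face (fun x => ~ A x)) (fun x => ~ F0 x))
    as [A [HA [H0 Hmax]]].
  - now rewrite Hcc.
  - intros C [A0 HA0] HC Htot.
    destruct (weak_cluster X Hrefl Hnt
      (fun G => exists A, C A /\ G = fun x => ~ A x) 1) as [x Hx].
    + now exists (fun x => ~ A0 x), A0.
    + intros G [A [HA ->]]. now apply HC.
    + intros G1 G2 [A1 [HA1 ->]] [A2 [HA2 ->]]. destruct (Htot A1 A2 HA1 HA2) as [H|H].
      * exists (fun x => ~ A2 x). split; [now exists A2|]. firstorder.
      * exists (fun x => ~ A1 x). split; [now exists A1|]. firstorder.
    + intros G y [A [HA ->]] Hy. now apply (HC A HA).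
    + split; [|split; [|split]].
      * exists x. intros [A [HA HAx]].
        destruct (HC A HA) as [_ [_ [Hw _]]]. apply (Hw x); [|easy].
        intros h c Hh Hc. apply (Hx h (fun x => ~ A x)); [easy|now exists A|easy].
      * intros y Hy. apply (HC A0 HA0). intros H. apply Hy. now exists A0.
      * intros y Hy [A [HA HAy]].
        destruct (HC A HA) as [_ [_ [Hw _]]]. apply (Hw y); [|easy].
        intros h c Hh Hc. apply Hy; [easy|]. intros z Hz. apply Hc.
        intros HAz. apply Hz. now exists A.
      * intros a u v t Ha Hu Hv Ht Hle.
        split; intros [A [HA HAu]]; destruct (HC A HA) as [_ [_ [_ Hf]]];
          (destruct (Hf a u v t) as [H1 H2];
           [intros HAa; apply Ha; now exists A|easy|easy|easy|easy|now auto]).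
  - exists (fun x => ~ A x). split; [easy|]. split.
    + intros x HAx. apply NNPP; intros H. auto.
    + intros G HG HGA x HAx. apply NNPP; intros HGx. apply HAx.
      apply (Hmax (fun x => ~ G x)); [now rewrite Hcc| |easy].
      intros y HAy HGy. now apply (HGA y).
Qed.

(** Passing to positive parts brings [x0] and [x1] into [pos_ball], so [x0^+ = a = x1^+]. Hence
    [x0, x1 <= a], and a convex combination of them above [a] leaves only equality. *)
Lemma order_extreme_of_singleton_face (F : X -> Prop) (a : X) :
  order_face F -> F a -> (forall x, F x -> x = a) ->
  order_extreme_point X (unit_ball X) a.
Proof.
  intros [_ [HFB [_ HFf]]] Ha Huniq. split; [now apply HFB|].
  intros x0 x1 t H0 H1 Ht Hle.
  assert (Hp : forall x, unit_ball X x -> pos_ball (vpos X x)).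
  { intros x Hx. split; [apply vpos_ge0|]. eapply Rle_trans; [apply vnorm_vpos|exact Hx]. }
  pose proof (vpos_ge X x0) as L0. pose proof (vpos_ge X x1) as L1.
  destruct (HFf a (vpos X x0) (vpos X x1) t) as [E0 E1]; [easy|auto|auto|easy| |].
  - apply vle_trans with (1 := Hle). clear Hle.
    apply vle_add2; (apply vle_scal; [lra|easy]).
  - apply Huniq in E0, E1. rewrite E0 in L0. rewrite E1 in L1.
    split; [|symmetry]; (apply vle_antisym; [easy|]); clear E0 E1 H0 H1.
    + apply vle_of_dual; intros f Hf.
      apply (pd_mono X f Hf) in Hle, L0, L1.
      rewrite (pd_add X f Hf), !(pd_scal X f Hf) in Hle. nra.
    + apply vle_of_dual; intros f Hf.
      apply (pd_mono X f Hf) in Hle, L0, L1.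
      rewrite (pd_add X f Hf), !(pd_scal X f Hf) in Hle. nra.
Qed.

Lemma positive_dual_argmax (f : X -> R) :
  positive_dual X f ->
  exists a, order_extreme_point X (unit_ball X) a /\ forall x, pos_ball x -> f x <= f a.
Proof.
  intros Hf.
  destruct (minimal_order_face _ (order_face_argmax pos_ball f pos_ball_face Hf))
    as [F [HF [HF0 Hmin]]].
  destruct (HF) as [[a Ha] _].
  exists a. split; [|now apply HF0].
  apply (order_extreme_of_singleton_face F); [easy|easy|].
  intros x Hx.
  (* The points of [F] maximizing [g] form a face, which is all of [F] by minimality. Positive
     functionals separate points, so [F] is a singleton. *)
  assert (H : forall g, positive_dual X g -> g x = g a).
  { intros g Hg. pose proof (Hmin _ (order_face_argmax F g HF Hg) (fun x H => proj1 H)) as H.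
    destruct (H x Hx) as [_ H1]. destruct (H a Ha) as [_ H2].
    apply Rle_antisym; auto. }
  apply vle_antisym; apply vle_of_dual; intros g Hg; rewrite (H g Hg); lra.
Qed.

End Faces.

(** * Components and order units *)

Section Components.
Variable X : BanachLattice.
Hypothesis Hrefl : reflexive X.
Hypothesis Hnt : exists x : X, 0 < vnorm X x.
Notation "0v" := (vzero X).
Infix "+v" := (vadd X) (at level 50, left associativity).
Notation "x -v y" := (vadd X x (vopp X y)) (at level 50, left associativity).
Infix "*v" := (vscal X) (at level 40, left associativity).
Infix "<=v" := (vle X) (at level 70).

Lemma vmeet_l (x y : X) : vmeet X x y <=v x.
Proof.
  pose proof (vjoin_l X (vopp X x) (vopp X y)) as H. unfold vmeet. dual_le.
Qed.

Lemma vmeet_r (x y : X) : vmeet X x y <=v y.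
Proof.
  pose proof (vjoin_r X (vopp X x) (vopp X y)) as H. unfold vmeet. dual_le.
Qed.

Lemma vmeet_glb (x y z : X) : z <=v x -> z <=v y -> z <=v vmeet X x y.
Proof.
  intros Hx Hy.
  assert (H : vjoin X (vopp X x) (vopp X y) <=v vopp X z)
    by (apply vjoin_lub; now apply vle_opp).
  unfold vmeet. clear Hx Hy. dual_le.
Qed.

Lemma vmeet_ge0 (x y : X) : 0v <=v x -> 0v <=v y -> 0v <=v vmeet X x y.
Proof. apply vmeet_glb. Qed.

(* For positive vectors this is the usual disjointness [vmeet x y = 0]. *)
Definition disjoint (x y : X) : Prop := forall z, z <=v x -> z <=v y -> z <=v 0v.

Lemma disjoint_sym (x y : X) : disjoint x y -> disjoint y x.
Proof. intros H z Hy Hx. now apply H. Qed.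

Lemma disjoint_mono (x x' w : X) : x' <=v x -> disjoint x w -> disjoint x' w.
Proof. intros H Hd z Hx Hw. apply Hd; [now apply vle_trans with x'|easy]. Qed.

(** Disjointness of [x] and [w] is applied to [t - y], which leaves [t <= y]. *)
Lemma disjoint_add (x y w : X) :
  0v <=v y -> disjoint x w -> disjoint y w -> disjoint (x +v y) w.
Proof.
  intros Hy Hx Hyw t H1 H2. apply Hyw; [|easy].
  assert (H : t -v y <=v 0v) by (apply Hx; dual_le).
  clear H1 H2. dual_le.
Qed.

(** The vector [x + y - b] lies below both [x] and [y]. *)
Lemma disjoint_sum_le (x y b : X) : disjoint x y -> x <=v b -> y <=v b -> x +v y <=v b.
Proof.
  intros Hd Hx Hy. assert (H : x +v y -v b <=v 0v) by (apply Hd; dual_le). dual_le.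
Qed.

(** If [w] is below both parts, [x^+ - w] is still an upper bound of [x] and 0, so it dominates
    [x^+]. *)
Lemma vpos_opp_disjoint (x : X) : disjoint (vpos X x) (vpos X (vopp X x)).
Proof.
  intros w H1 H2.
  pose proof (vpos_ge X x) as L1. pose proof (vpos_ge0 X x) as L2.
  assert (H3 : vpos X (vopp X x) <=v vpos X x -v x) by (apply vjoin_lub; dual_le).
  assert (H4 : vpos X x <=v vpos X x -v w) by (apply vjoin_lub; dual_le).
  clear - H4. dual_le.
Qed.

(** Reflexivity supplies the order completeness: a weak cluster point of the sequence is its
    supremum. *)
Lemma increasing_bounded_sup (s : nat -> X) (e : X) :
  (forall n m, (n <= m)%nat -> s n <=v s m) ->
  (forall n, 0v <=v s n) -> (forall n, s n <=v e) ->
  exists c, (forall n, s n <=v c) /\ forall b, (forall n, s n <=v b) -> c <=v b.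
Proof.
  intros Hmono H0 He.
  destruct (weak_cluster_seq X Hrefl Hnt s (vnorm X e)) as [c Hc].
  - intros n. now apply vnorm_mono.
  - exists c. split.
    + intros n. apply vle_of_dual; intros f Hf. apply (Hc f (proj1 Hf) n).
      intros m Hm. apply pd_mono; auto.
    + intros b Hb. apply vle_of_dual; intros f Hf. apply (Hc f (proj1 Hf) O).
      intros m _. now apply pd_mono.
Qed.

Lemma disjoint_sup (s : nat -> X) (c w : X) :
  (forall n, s n <=v c) -> (forall b, (forall n, s n <=v b) -> c <=v b) ->
  0v <=v c -> 0v <=v w -> (forall n, disjoint (s n) w) -> disjoint c w.
Proof.
  intros Hub Hlub Hc Hw Hd t H1 H2.
  assert (T1 : vpos X t <=v c) by now apply vjoin_lub.
  assert (T2 : vpos X t <=v w) by now apply vjoin_lub.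
  assert (H : c <=v c -v vpos X t).
  { apply Hlub. intros n.
    assert (H : s n +v vpos X t <=v c).
    { apply disjoint_sum_le; [|easy|easy].
      apply disjoint_sym, (disjoint_mono w); [easy|]. apply disjoint_sym, Hd. }
    clear - H. dual_le. }
  pose proof (vpos_ge X t) as H3. clear - H H3. dual_le.
Qed.

(* [c] is the projection of [e] onto the band generated by [z]. *)
Lemma component_exists (e z : X) :
  0v <=v z -> z <=v e ->
  exists c, 0v <=v c /\ c <=v e /\ z <=v c /\ disjoint c (e -v c) /\
    forall w, 0v <=v w -> disjoint z w -> disjoint c w.
Proof.
  intros Hz Hze.
  assert (He : 0v <=v e) by now apply vle_trans with z.
  (* The classical formula for the band projection: the supremum of [n z] truncated at [e]. *)
  pose (s := fun n => vmeet X (INR n *v z) e).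
  assert (Hnz : forall n, 0v <=v INR n *v z).
  { intros n. replace 0v with (INR n *v 0v) by vec.
    apply vle_scal; [apply pos_INR|easy]. }
  destruct (increasing_bounded_sup s e) as [c [Hub Hlub]].
  - intros n m Hnm. apply vmeet_glb; [|apply vmeet_r].
    apply vle_trans with (INR n *v z); [apply vmeet_l|].
    apply vle_of_dual; intros f Hf. rewrite !pd_scal by easy.
    apply Rmult_le_compat_r; [now apply Hf|now apply le_INR].
  - intros n. now apply vmeet_ge0.
  - intros n. apply vmeet_r.
  - assert (Hzc : z <=v c).
    { apply vle_trans with (s 1%nat); [|easy].
      apply vmeet_glb; [|easy]. cbn. rewrite vscal_1. apply vle_refl. }
    assert (Hce : c <=v e) by (apply Hlub; intros; apply vmeet_r).
    assert (Hc0 : 0v <=v c) by now apply vle_trans with z.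
    assert (Hec : 0v <=v e -v c) by (clear - Hce; dual_le).
    assert (Hband : forall w, 0v <=v w -> disjoint z w -> disjoint c w).
    { intros w Hw Hd. apply (disjoint_sup s); try easy.
      intros n. apply (disjoint_mono (INR n *v z)); [apply vmeet_l|].
      induction n as [|n IH].
      - cbn. intros t Ht _. replace 0v with (0 *v z) by vec. exact Ht.
      - rewrite S_INR. replace ((INR n + 1) *v z) with (INR n *v z +v z) by vec.
        now apply disjoint_add. }
    exists c. split; [easy|]. split; [easy|]. split; [easy|]. split; [|easy].
    apply Hband; [easy|]. intros t H1 H2.
    assert (T1 : vpos X t <=v z) by now apply vjoin_lub.
    assert (T2 : vpos X t <=v e -v c) by now apply vjoin_lub.
    assert (H : c <=v c -v vpos X t).
    { apply Hlub. intros n.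
      (* The bound [t^+ <= z] pays for the step from [n z] to [(n + 1) z], and [t^+ <= e - c] leaves
         the room below [e]. So [c - t^+] bounds every [s n]. *)
      assert (H : s n +v vpos X t <=v s (S n)).
      { apply vmeet_glb.
        - rewrite S_INR. pose proof (vmeet_l (INR n *v z) e) as H.
          fold (s n) in H. clear - H T1. dual_le.
        - pose proof (Hub n) as H. clear - H T2. dual_le. }
      pose proof (Hub (S n)) as H'. clear - H H'. dual_le. }
    pose proof (vpos_ge X t) as H3. clear - H H3. dual_le.
Qed.

Lemma riesz_decomposition (y e f : X) :
  0v <=v y -> 0v <=v e -> 0v <=v f -> y <=v e +v f ->
  exists y1 y2, y = y1 +v y2 /\ 0v <=v y1 /\ y1 <=v e /\ 0v <=v y2 /\ y2 <=v f.
Proof.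
  intros Hy He Hf H.
  exists (vmeet X y e), (y -v vmeet X y e).
  pose proof (vmeet_l y e) as H1. pose proof (vmeet_r y e) as H2.
  split; [vec|]. split; [now apply vmeet_ge0|]. split; [easy|].
  split; [clear - H1; dual_le|].
  assert (H3 : y -v f <=v vmeet X y e) by (apply vmeet_glb; [clear - Hf|clear - H]; dual_le).
  clear - H3. dual_le.
Qed.

(** The component of [e] generated by [(y - t e)^+] is 0 or [e], which makes [y] comparable with
    every [t e]. Then [y = l e] for the supremum [l] of the [t] with [t e <= y]. *)
Lemma multiples_of_unsplittable (e : X) :
  0v <=v e ->
  (forall c, 0v <=v c -> c <=v e -> disjoint c (e -v c) -> c = 0v \/ c = e) ->
  forall y, 0v <=v y -> y <=v e -> exists t, y = t *v e.
Proof.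
  intros He Hat y Hy Hye.
  assert (Hdich : forall t, 0 <= t <= 1 -> y <=v t *v e \/ t *v e <=v y).
  { intros t Ht.
    assert (Hte : 0v <=v t *v e).
    { replace 0v with (t *v 0v) by vec. now apply vle_scal. }
    assert (Hte1 : t *v e <=v e).
    { apply vle_of_dual; intros f Hf. rewrite pd_scal by easy.
      pose proof (proj2 Hf e He). nra. }
    destruct (component_exists e (vpos X (y -v t *v e))) as [c [Hc0 [Hce [Hzc [Hd Hband]]]]].
    - apply vpos_ge0.
    - apply vjoin_lub; [|easy]. clear - Hte Hye. apply vle_trans with y; [|easy].
      apply vle_sub. replace (y -v (y -v t *v e)) with (t *v e) by vec. exact Hte.
    - pose proof (vpos_ge X (y -v t *v e)) as H1.
      destruct (Hat c Hc0 Hce Hd) as [->| ->].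
      + left. clear - H1 Hzc.
        assert (H : y -v t *v e <=v 0v) by now apply vle_trans with (vpos X (y -v t *v e)).
        dual_le.
      + right.
        (* The negative part of [y - t e] is disjoint from the positive part, hence from the
           component [e], yet lies below [e]. *)
        assert (H2 : vpos X (vopp X (y -v t *v e)) <=v 0v).
        { apply (Hband (vpos X (vopp X (y -v t *v e)))).
          - apply vpos_ge0.
          - apply vpos_opp_disjoint.
          - apply vjoin_lub; [|easy]. clear - Hte1 Hy. dual_le.
          - apply vle_refl. }
        pose proof (vpos_ge X (vopp X (y -v t *v e))) as H3.
        assert (H : vopp X (y -v t *v e) <=v 0v)
          by now apply vle_trans with (vpos X (vopp X (y -v t *v e))).
        clear - H. dual_le. }
  destruct (completeness (fun t => 0 <= t <= 1 /\ t *v e <=v y)) as [l [Hub Hlub]].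
  - exists 1. intros t [Ht _]. lra.
  - exists 0. split; [lra|]. now replace (0 *v e) with 0v by vec.
  - assert (Hl0 : 0 <= l).
    { apply Hub. split; [lra|]. now replace (0 *v e) with 0v by vec. }
    assert (Hl1 : l <= 1) by (apply Hlub; intros t [Ht _]; lra).
    exists l. apply vle_antisym; apply vle_of_dual; intros f Hf;
      rewrite pd_scal by easy; pose proof (proj2 Hf e He) as Hfe.
    + apply Rnot_lt_le; intros Hlt.
      pose proof (pd_mono X f Hf _ _ Hye) as Hfy.
      assert (Hfe0 : 0 < f e) by nra.
      (* The midpoint of [l] and [t] violates both alternatives: [f] excludes [y] below that
         multiple of [e], and the choice of [l] excludes [y] above it. *)
      pose (t := f y / f e).
      assert (Hft : f y = t * f e) by (unfold t; field; lra).
      assert (l < t <= 1) by nra.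
      destruct (Hdich ((l + t) / 2)) as [H1|H1]; [lra| |].
      * apply (pd_mono X f Hf) in H1. rewrite pd_scal in H1 by easy. nra.
      * assert ((l + t) / 2 <= l); [|lra]. apply Hub. split; [lra|easy].
    + apply Rnot_lt_le; intros Hlt.
      pose proof (proj2 Hf y Hy) as Hfy.
      assert (Hfe0 : 0 < f e) by nra.
      assert (l <= f y / f e).
      { apply Hlub. intros t [Ht H]. apply (pd_mono X f Hf) in H.
        rewrite pd_scal in H by easy.
        apply Rmult_le_reg_r with (f e); [easy|].
        replace (f y / f e * f e) with (f y) by (field; lra). easy. }
      assert (f y / f e * f e = f y) by (field; lra). nra.
Qed.

Definition finitely_spanned (S : X -> Prop) : Prop :=
  exists n v, forall y, S y -> exists c, y = lincomb X c v n.

Definition interval (x y : X) : Prop := 0v <=v y /\ y <=v x.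

Lemma lincomb_ext (c d : nat -> R) (v w : nat -> X) (n : nat) :
  (forall i, (i < n)%nat -> c i = d i /\ v i = w i) -> lincomb X c v n = lincomb X d w n.
Proof.
  induction n as [|n IH]; intros H; cbn; [easy|].
  rewrite IH by (intros; apply H; lia). destruct (H n) as [-> ->]; [lia|easy].
Qed.

Lemma lincomb_app (c d : nat -> R) (v w : nat -> X) (n m : nat) :
  lincomb X (fun i => if Nat.ltb i n then c i else d (i - n)%nat)
    (fun i => if Nat.ltb i n then v i else w (i - n)%nat) (n + m) =
  lincomb X c v n +v lincomb X d w m.
Proof.
  induction m as [|m IH].
  - rewrite Nat.add_0_r. cbn [lincomb]. rewrite vadd_0. apply lincomb_ext. intros i Hi.
    apply Nat.ltb_lt in Hi. cbv beta. now rewrite Hi.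
  - rewrite Nat.add_succ_r. cbn [lincomb]. rewrite IH, vadd_assoc.
    replace (n + m - n)%nat with m by lia.
    destruct (Nat.ltb_spec (n + m) n); [lia|easy].
Qed.

(** By Riesz decomposition the interval up to [e + f] is contained in the sum of the two
    intervals. *)
Lemma finitely_spanned_add (e f : X) :
  0v <=v e -> 0v <=v f ->
  finitely_spanned (interval e) -> finitely_spanned (interval f) ->
  finitely_spanned (interval (e +v f)).
Proof.
  intros He Hf [n [v Hv]] [m [w Hw]].
  exists (n + m)%nat, (fun i => if Nat.ltb i n then v i else w (i - n)%nat).
  intros y [Hy Hyef].
  destruct (riesz_decomposition y e f) as [y1 [y2 [-> [H1 [H2 [H3 H4]]]]]]; try easy.
  destruct (Hv y1) as [c ->]; [easy|]. destruct (Hw y2) as [d ->]; [easy|].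
  exists (fun i => if Nat.ltb i n then c i else d (i - n)%nat). now rewrite lincomb_app.
Qed.

(** If [x] had no proper component, its interval would lie on a line. For a proper component [c],
    the intervals of [c] and [x - c] cannot both be finitely spanned, and [x'] is one for which this
    fails. *)
Lemma split_off_component (x : X) :
  0v <=v x -> ~ finitely_spanned (interval x) ->
  exists x', 0v <=v x' /\ x' <=v x /\ disjoint (x -v x') x' /\ x <> x' /\
    ~ finitely_spanned (interval x').
Proof.
  intros Hx Hbig.
  destruct (classic (forall c, 0v <=v c -> c <=v x -> disjoint c (x -v c) -> c = 0v \/ c = x))
    as [Hat|Hn].
  - elim Hbig. exists 1%nat, (fun _ => x). intros y [Hy Hyx].
    destruct (multiples_of_unsplittable x Hx Hat y Hy Hyx) as [t ->].
    exists (fun _ => t). cbn. vec.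
  - apply not_all_ex_not in Hn as [c Hc].
    apply imply_to_and in Hc as [Hc0 Hc]. apply imply_to_and in Hc as [Hcx Hc].
    apply imply_to_and in Hc as [Hd Hc]. apply not_or_and in Hc as [Hne0 Hnex].
    assert (Hxc : 0v <=v x -v c) by (clear - Hcx; dual_le).
    destruct (classic (finitely_spanned (interval c))) as [Hs|Hs].
    + exists (x -v c). split; [easy|]. split; [clear - Hc0; dual_le|].
      replace (x -v (x -v c)) with c by vec. split; [easy|]. split.
      * intros E. apply Hne0. replace c with (x -v (x -v c)) by vec.
        rewrite <- E. apply vadd_opp.
      * intros Hs'. apply Hbig. replace x with (c +v (x -v c)) by vec.
        now apply finitely_spanned_add.
    + exists c. split; [easy|]. split; [easy|]. split; [now apply disjoint_sym|]. split; [|easy].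
      intros E. now apply Hnex.
Qed.

End Components.

(** * Linear dependence of n + 1 rows of length n *)

Section LinearDependence.
Import all_boot all_algebra Rstruct GRing.Theory.

Lemma sum_f_R0_bigop (f : nat -> R) (n : nat) :
  sum_f_R0 f n = (\sum_(i < n.+1) f i)%R.
Proof.
elim: n => [|n IH] /=; first by rewrite big_ord_recl big_ord0 addr0.
by rewrite big_ord_recr /= IH.
Qed.

(** The rank is at most [n], so the left kernel of the [(n + 1)] by [n] matrix is nonzero. *)
Lemma rows_dependent (n : nat) (a : nat -> nat -> R) :
  exists c : nat -> R, (exists i, (i < n.+1)%coq_nat /\ c i <> IZR 0) /\
    forall j, (j < n)%coq_nat -> sum_f_R0 (fun i => Rmult (c i) (a i j)) n = IZR 0.
Proof.
pose A : 'M[R]_(n.+1, n) := (\matrix_(i, j) a i j)%R.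
have kerN0 : kermx A != 0%R.
  rewrite -mxrank_eq0 mxrank_ker -lt0n subn_gt0 ltnS; exact: rank_leq_col.
have [v vA vN0] := rowV0Pn kerN0.
exists (fun i => v ord0 (inord i)); split.
  have [i vi] : exists i, v ord0 i != 0%R.
    by have /rV0Pn := vN0.
  exists i; split; first exact/ltP.
  by rewrite inord_val; apply/eqP.
move=> j /ltP jn; rewrite sum_f_R0_bigop.
have /matrixP/(_ ord0 (Ordinal jn)) : (v *m A)%R = 0%R by apply/sub_kermxP.
rewrite !mxE => E; apply: etrans E; apply: eq_bigr => i _.
by rewrite !mxE inord_val.
Qed.
End LinearDependence.

(** * Infinite dimension excludes order units *)

Section NoOrderUnit.
Variable X : BanachLattice.
Hypothesis Hrefl : reflexive X.
Hypothesis Hinf : infinite_dimensional X.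
Notation "0v" := (vzero X).
Infix "+v" := (vadd X) (at level 50, left associativity).
Notation "x -v y" := (vadd X x (vopp X y)) (at level 50, left associativity).
Infix "*v" := (vscal X) (at level 40, left associativity).
Infix "<=v" := (vle X) (at level 70).

Lemma infinite_dimensional_nontrivial : exists x : X, 0 < vnorm X x.
Proof.
  destruct (Hinf 1%nat) as [v Hv]. exists (v O).
  destruct (vnorm_nonneg X (v O)) as [H|H]; [easy|].
  symmetry in H. apply vnorm_eq0 in H.
  assert (1 = 0); [|lra]. apply (Hv (fun _ => 1)) with (i := O); [|lia].
  cbn. rewrite H. vec.
Qed.

Lemma lincomb_add (c d : nat -> R) (v : nat -> X) (n : nat) :
  lincomb X (fun i => c i + d i) v n = lincomb X c v n +v lincomb X d v n.
Proof. induction n as [|n IH]; cbn; [vec|]. rewrite IH. vec. Qed.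

Lemma lincomb_scal (t : R) (c : nat -> R) (v : nat -> X) (n : nat) :
  lincomb X (fun i => t * c i) v n = t *v lincomb X c v n.
Proof. induction n as [|n IH]; cbn; [vec|]. rewrite IH. vec. Qed.

Lemma lincomb_0 (v : nat -> X) (n : nat) : lincomb X (fun _ => 0) v n = 0v.
Proof. induction n as [|n IH]; cbn; [easy|]. rewrite IH. vec. Qed.

Lemma lincomb_lincomb (c : nat -> R) (a : nat -> nat -> R) (v : nat -> X) (n m : nat) :
  lincomb X c (fun i => lincomb X (a i) v n) (S m) =
  lincomb X (fun j => sum_f_R0 (fun i => c i * a i j) m) v n.
Proof.
  induction m as [|m IH].
  - cbn. rewrite lincomb_scal. vec.
  - cbn [lincomb sum_f_R0] in *. rewrite lincomb_add, IH, lincomb_scal. reflexivity.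
Qed.

Lemma not_finitely_spanned : ~ finitely_spanned X (fun _ => True).
Proof.
  intros [n [v Hv]]. destruct (Hinf (S n)) as [w Hw].
  pose (a := fun i => proj1_sig (constructive_indefinite_description _ (Hv (w i) I))).
  assert (Ha : forall i, w i = lincomb X (a i) v n).
  { intros i. unfold a. apply proj2_sig. }
  destruct (rows_dependent n a) as [c [[i [Hi Hci]] Hc]].
  apply Hci, Hw; [|easy].
  rewrite (lincomb_ext X c c w (fun i => lincomb X (a i) v n)) by auto.
  rewrite lincomb_lincomb, <- (lincomb_0 v n). apply lincomb_ext. auto.
Qed.

Lemma order_unit_not_finitely_spanned (u : X) :
  (forall w, pos_ball X w -> w <=v u) -> ~ finitely_spanned X (interval X u).
Proof.
  intros Hu [n [v Hv]]. apply not_finitely_spanned. exists n, v. intros y _.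
  assert (Hpos : forall w, 0v <=v w -> exists c, w = lincomb X c v n).
  { intros w Hw. pose proof (vnorm_nonneg X w) as Hn.
    (* Dividing by [||w|| + 1] moves [w] into the interval up to [u], also when [w = 0]. *)
    assert (Hi : 0 < / (vnorm X w + 1)) by (apply Rinv_0_lt_compat; lra).
    destruct (Hv (/ (vnorm X w + 1) *v w)) as [c Hc].
    - assert (H0 : 0v <=v / (vnorm X w + 1) *v w).
      { replace 0v with (/ (vnorm X w + 1) *v 0v) by vec. apply vle_scal; [lra|easy]. }
      split; [easy|]. apply Hu. split; [easy|].
      rewrite vnorm_scal, Rabs_pos_eq by lra.
      apply Rmult_le_reg_l with (vnorm X w + 1); [lra|].
      rewrite <- Rmult_assoc, Rinv_r by lra. lra.
    - exists (fun i => (vnorm X w + 1) * c i). rewrite lincomb_scal, <- Hc. vec. }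
  destruct (Hpos (vpos X y)) as [c Hc]; [apply vpos_ge0|].
  destruct (Hpos (vpos X y -v y)) as [d Hd].
  { pose proof (vpos_ge X y) as H. dual_le. }
  exists (fun i => c i + -1 * d i). rewrite lincomb_add, lincomb_scal, <- Hc, <- Hd. vec.
Qed.

(** With [t = ||e|| < 1], the vector [e / t] is in the ball, so [e <= t u]. Then
    [(1 - t) e <= t (u - e) <= u - e], and disjointness gives [e = 0]. *)
Lemma disjoint_component_norm (u e : X) :
  (forall w, pos_ball X w -> w <=v u) ->
  0v <=v e -> e <=v u -> disjoint X e (u -v e) -> e <> 0v -> 1 <= vnorm X e.
Proof.
  intros Hu He Heu Hd Hne. apply Rnot_lt_le; intros Hlt.
  apply Hne, vle_antisym; [|easy].
  assert (Ht : 0 < vnorm X e).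
  { destruct (vnorm_nonneg X e) as [H|H]; [easy|]. elim Hne. now apply vnorm_eq0. }
  set (t := vnorm X e) in *.
  assert (H1 : e <=v t *v u).
  { replace e with (t *v (/ t *v e)) by vec. apply vle_scal; [lra|]. apply Hu.
    assert (0 < / t) by now apply Rinv_0_lt_compat. split.
    - replace 0v with (/ t *v 0v) by vec. apply vle_scal; [lra|easy].
    - rewrite vnorm_scal, Rabs_pos_eq by lra. fold t. rewrite Rinv_l; lra. }
  assert (H2 : (1 - t) *v e <=v 0v).
  { apply Hd; apply vle_of_dual; intros f Hf; pose proof (proj2 Hf e He);
      apply (pd_mono X f Hf) in H1, Heu;
      rewrite ?(pd_add X f Hf), ?(pd_opp X f Hf), ?(pd_scal X f Hf) in *; nra. }
  apply vle_of_dual; intros f Hf. apply (pd_mono X f Hf) in H2.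
  rewrite (pd_0 X f Hf), (pd_scal X f Hf) in *. nra.
Qed.

(* A decreasing sequence of components of an order unit could drop infinitely
   often by vectors of norm at least 1, contradicting Mazur's theorem. *)
Lemma no_order_unit (u : X) : exists w, pos_ball X w /\ ~ w <=v u.
Proof.
  apply NNPP; intros Hn.
  assert (Hu : forall w, pos_ball X w -> w <=v u).
  { intros w Hw. apply NNPP; intros H. apply Hn. now exists w. }
  clear Hn. pose proof infinite_dimensional_nontrivial as Hnt.
  assert (Hu0 : 0v <=v u) by apply Hu, pos_ball_0.
  pose (good := fun x : X => 0v <=v x /\ ~ finitely_spanned X (interval X x)).
  (* The premise stands inside the existential so that choice yields a total [next] that can be
     iterated. *)
  assert (Hstep : forall x, exists x', good x ->
     good x' /\ x' <=v x /\ disjoint X (x -v x') x' /\ x <> x').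
  { intros x. destruct (classic (good x)) as [[H1 H2]|H]; [|now exists x].
    destruct (split_off_component X Hrefl Hnt x H1 H2) as [x' [H3 [H4 [H5 [H6 H7]]]]].
    exists x'. intros _. now repeat split. }
  pose (next := fun x => proj1_sig (constructive_indefinite_description _ (Hstep x))).
  assert (Hnext : forall x, good x -> good (next x) /\ next x <=v x /\
            disjoint X (x -v next x) (next x) /\ x <> next x).
  { intros x. exact (proj2_sig (constructive_indefinite_description _ (Hstep x))). }
  pose (s := fun n => Nat.iter n next u).
  assert (Hgood : forall n, good (s n)).
  { induction n as [|n IH]; [|now apply Hnext].
    split; [easy|]. now apply order_unit_not_finitely_spanned. }
  assert (Hdec : forall n m, (n <= m)%nat -> s m <=v s n).
  { intros n m H. induction H as [|m H IH]; [apply vle_refl|].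
    apply vle_trans with (s m); [|easy]. now apply Hnext. }
  assert (Hdu : forall n, disjoint X (u -v s n) (s n)).
  { induction n as [|n IH].
    - intros z Hz _. cbn in Hz. now rewrite vadd_opp in Hz.
    - destruct (Hnext (s n) (Hgood n)) as [_ [Hle [Hd _]]].
      change (next (s n)) with (s (S n)) in *.
      replace (u -v s (S n)) with ((u -v s n) +v (s n -v s (S n))) by vec.
      apply disjoint_add; [clear - Hle; dual_le| |easy].
      apply disjoint_sym, (disjoint_mono X (s n)); [easy|]. now apply disjoint_sym. }
  (* Each drop is a component of [u]: its complement [s (n+1) + (u - s n)] is a sum of two vectors
     disjoint from it. *)
  assert (Hdrop : forall n, 1 <= vnorm X (s n -v s (S n))).
  { intros n. destruct (Hnext (s n) (Hgood n)) as [_ [Hle [Hd Hne]]].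
    change (next (s n)) with (s (S n)) in *.
    pose proof (proj1 (Hgood (S n))) as H0. pose proof (Hdec O n ltac:(lia)) as Hsu.
    change (s O) with u in Hsu.
    apply (disjoint_component_norm u); [easy| | | |].
    - clear - Hle; dual_le.
    - clear - H0 Hsu; dual_le.
    - replace (u -v (s n -v s (S n))) with (s (S n) +v (u -v s n)) by vec.
      apply disjoint_sym, disjoint_add; [clear - Hsu; dual_le|now apply disjoint_sym|].
      apply disjoint_sym, (disjoint_mono X (s n)); [clear - H0; dual_le|].
      apply disjoint_sym, Hdu.
    - intros E. apply Hne. replace (s n) with ((s n -v s (S n)) +v s (S n)) by vec.
      rewrite E. rewrite vadd_comm. apply vadd_0. }
  destruct (weak_cluster_seq X Hrefl Hnt s (vnorm X u)) as [x Hx].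
  { intros n. apply vnorm_mono; [apply Hgood|]. apply (Hdec O n). lia. }
  assert (Hxs : forall n, x <=v s n).
  { intros n. apply vle_of_dual; intros f Hf. apply (Hx f (proj1 Hf) n).
    intros m Hm. apply pd_mono; auto. }
  (* Since [x <= s (n+1)], the vector [s n - x] dominates the drop and has norm at least 1. The
     resulting [f] has [f (s n) >= f x + 1] for all [n], which the cluster property of [x]
     forbids. *)
  destruct (positive_functional_above X (fun y => exists n, y = s n -v x) 1) as [f [Hf [_ H1]]].
  - now exists (s O -v x), O.
  - intros y y' [n ->] [m ->]. exists (s (Nat.max n m) -v x).
    split; [now exists (Nat.max n m)|].
    split; apply vle_add, Hdec; lia.
  - intros y [n ->]. pose proof (Hxs n) as H. pose proof (Hxs (S n)) as H'.
    rewrite vpos_of_ge0 by (clear - H; dual_le).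
    apply Rle_trans with (1 := Hdrop n). apply vnorm_mono; [|clear - H'; dual_le].
    pose proof (Hdec n (S n) ltac:(lia)) as Hle. clear - Hle; dual_le.
  - assert (f x + 1 <= f x); [|lra].
    apply (Hx f (proj1 Hf) O). intros m _.
    pose proof (H1 (s m -v x) (ex_intro _ m eq_refl)) as H.
    rewrite (pd_add X f Hf), (pd_opp X f Hf) in H. lra.
Qed.

End NoOrderUnit.

(** * A functional that attains its norm at none of countably many points *)

Lemma limit_le (U : nat -> R) (l b : R) (j : nat) :
  Un_cv U l -> (forall n, (j <= n)%nat -> U n <= b) -> l <= b.
Proof.
  intros Hl Hb. apply Rnot_lt_le; intros Hlt.
  destruct (Hl (l - b)) as [N HN]; [lra|].
  specialize (HN (Nat.max j N) ltac:(lia)). specialize (Hb (Nat.max j N) ltac:(lia)).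
  unfold Rdist in HN. apply Rabs_def2 in HN. lra.
Qed.

Section Construction.
Variable X : BanachLattice.
Hypothesis Hrefl : reflexive X.
Hypothesis Hinf : infinite_dimensional X.
Notation "0v" := (vzero X).
Infix "<=v" := (vle X) (at level 70).

Lemma positive_dual_add_scal (f g : X -> R) (s : R) :
  positive_dual X f -> positive_dual X g -> 0 <= s ->
  positive_dual X (fun x => f x + s * g x).
Proof.
  intros [[Ha [Hs [m Hm]]] Hp] [[Ha' [Hs' [m' Hm']]] Hp'] Hs0.
  split; [split; [|split]|].
  - intros; rewrite Ha, Ha'; ring.
  - intros; rewrite Hs, Hs'; ring.
  - exists (m + s * m'). intros x. eapply Rle_trans; [apply Rabs_triang|].
    rewrite Rabs_mult, (Rabs_pos_eq s) by easy.
    pose proof (Hm x). pose proof (Hm' x). nra.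
  - intros x Hx. pose proof (Hp x Hx). pose proof (Hp' x Hx). nra.
Qed.

Lemma positive_dual_zero : positive_dual X (fun _ => 0).
Proof.
  split; [split; [|split]|]; try (intros; lra).
  exists 0. intros x. rewrite Rabs_R0. lra.
Qed.

Lemma positive_dual_le_norm (f : X -> R) (x : X) :
  positive_dual X f -> (forall y, pos_ball X y -> f y <= 1) -> 0v <=v x -> f x <= vnorm X x.
Proof.
  intros Hf H1 Hx. destruct (vnorm_nonneg X x) as [Hn|Hn].
  - set (t := vnorm X x) in *. assert (Hi : 0 < / t) by now apply Rinv_0_lt_compat.
    assert (H : f (vscal X (/ t) x) <= 1).
    { apply H1. split.
      - replace 0v with (vscal X (/ t) 0v) by vec. apply vle_scal; [lra|easy].
      - rewrite vnorm_scal, Rabs_pos_eq by lra. fold t. rewrite Rinv_l; lra. }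
    rewrite (pd_scal X f Hf) in H.
    replace (f x) with (t * (/ t * f x)) by (field; lra).
    rewrite <- (Rmult_1_r t) at 3. apply Rmult_le_compat_l; lra.
  - rewrite <- Hn. symmetry in Hn. apply vnorm_eq0 in Hn. subst x. rewrite pd_0 by easy. lra.
Qed.

(** Take [w] in the ball not below [N u]; a functional [g] supporting [||x^+||] at [w - N u] has
    [N g u < g w]. The largest [s] for which [f + s g] stays below [c'] satisfies [s g w <= c'], so
    [s g u <= c' / N], and [N = c' / eps] makes this [eps]. *)
Lemma enlarge_functional (f : X -> R) (c c' eps : R) (u : X) :
  positive_dual X f -> c < c' -> (forall x, pos_ball X x -> f x <= c) ->
  0v <=v u -> 0 < eps ->
  exists f', positive_dual X f' /\ (forall x, 0v <=v x -> f x <= f' x) /\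
    (forall x, pos_ball X x -> f' x <= c') /\ f' u <= f u + eps /\
    forall delta, 0 < delta -> exists x, pos_ball X x /\ c' - delta < f' x.
Proof.
  intros Hf Hcc Hc Hu Heps.
  assert (Hc0 : 0 <= c).
  { rewrite <- (pd_0 X f Hf). apply Hc, pos_ball_0. }
  set (N := c' / eps). assert (HN : N * eps = c') by (unfold N; field; lra).
  assert (HN0 : 0 < N) by (apply Rmult_lt_0_compat; [lra|now apply Rinv_0_lt_compat]).
  destruct (no_order_unit X Hrefl Hinf (vscal X N u)) as [w [Hw Hwu]].
  destruct (positive_functional_at X (vadd X w (vopp X (vscal X N u)))) as [g [Hg [Hgle E]]].
  assert (Hgw : N * g u < g w).
  { rewrite (pd_add X g Hg), (pd_opp X g Hg), (pd_scal X g Hg) in E.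
    destruct (vnorm_nonneg X (vpos X (vadd X w (vopp X (vscal X N u))))) as [H|H]; [lra|].
    elim Hwu. apply vle_of_vpos_eq0. now symmetry. }
  assert (Hgu : 0 <= g u) by now apply Hg.
  assert (Hgw0 : 0 < g w) by nra.
  destruct (completeness (fun s => 0 <= s /\ forall x, pos_ball X x -> f x + s * g x <= c'))
    as [s [Hub Hlub]].
  - exists (c' / g w). intros s [_ Hs].
    apply Rmult_le_reg_r with (g w); [easy|].
    replace (c' / g w * g w) with c' by (field; lra).
    specialize (Hs w Hw). pose proof (proj2 Hf w (proj1 Hw)). lra.
  - exists 0. split; [lra|]. intros x Hx. specialize (Hc x Hx). lra.
  - assert (Hs0 : 0 <= s).
    { apply Hub. split; [lra|]. intros x Hx. specialize (Hc x Hx). lra. }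
    assert (Hle : forall x, pos_ball X x -> f x + s * g x <= c').
    { intros x Hx. apply Rnot_lt_le; intros Hlt.
      pose proof (Hc x Hx). pose proof (proj2 Hg x (proj1 Hx)).
      assert (Hgx : 0 < g x) by nra.
      assert (s <= (c' - f x) / g x).
      { apply Hlub. intros t [_ Ht]. apply Rmult_le_reg_r with (g x); [easy|].
        replace ((c' - f x) / g x * g x) with (c' - f x) by (field; lra).
        specialize (Ht x Hx). lra. }
      assert ((c' - f x) / g x * g x = c' - f x) by (field; lra). nra. }
    exists (fun x => f x + s * g x). split; [now apply positive_dual_add_scal|].
    split; [|split; [easy|split]].
    + intros x Hx. pose proof (proj2 Hg x Hx). nra.
    + pose proof (Hle w Hw). pose proof (proj2 Hf w (proj1 Hw)).
      assert (N * (s * g u) <= N * eps) by nra.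
      assert (s * g u <= eps) by (apply Rmult_le_reg_l with N; lra). lra.
    (* As [g <= 1] on the ball, a gap of [delta] would allow [s] to grow by [delta]. *)
    + intros delta Hdelta. apply NNPP; intros Hn.
      assert (s + delta <= s); [|lra]. apply Hub. split; [lra|]. intros x Hx.
      assert (f x + s * g x <= c' - delta).
      { apply Rnot_lt_le; intros H. apply Hn. now exists x. }
      pose proof (Hgle x). pose proof (vnorm_vpos X x). pose proof (proj2 Hx).
      pose proof (proj2 Hg x (proj1 Hx)). nra.
Qed.

Fixpoint vabs_sum (a : nat -> X) (n : nat) : X :=
  match n with
  | O => vabs X (a O)
  | S m => vadd X (vabs_sum a m) (vabs X (a (S m)))
  end.

Lemma vabs_sum_ge0 (a : nat -> X) (n : nat) : 0v <=v vabs_sum a n.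
Proof.
  induction n as [|n IH]; cbn; [apply vabs_ge0|].
  pose proof (vabs_ge0 X (a (S n))) as H. dual_le.
Qed.

Lemma vabs_le_vabs_sum (a : nat -> X) (j n : nat) :
  (j <= n)%nat -> vabs X (a j) <=v vabs_sum a n.
Proof.
  induction 1 as [|n H IH].
  - destruct j; cbn; [apply vle_refl|]. pose proof (vabs_sum_ge0 a j) as H. dual_le.
  - cbn. pose proof (vabs_ge0 X (a (S n))) as H1. clear H. dual_le.
Qed.

Lemma half_pow_pos (n : nat) : 0 < (/ 2) ^ n.
Proof. apply pow_lt. lra. Qed.

Lemma functional_sequence (a : nat -> X) :
  exists F : nat -> X -> R,
    (forall n, positive_dual X (F n)) /\
    (forall n x, pos_ball X x -> F n x <= 1 - (/ 2) ^ n) /\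
    (forall n x, 0v <=v x -> F n x <= F (S n) x) /\
    (forall n, F (S n) (vabs_sum a n) <= F n (vabs_sum a n) + (/ 2) ^ (n + 2)) /\
    (forall n delta, 0 < delta -> exists x, pos_ball X x /\ 1 - (/ 2) ^ S n - delta < F (S n) x).
Proof.
  pose (good := fun n (f : X -> R) =>
    positive_dual X f /\ forall x, pos_ball X x -> f x <= 1 - (/ 2) ^ n).
  pose (step := fun n (f f' : X -> R) =>
    (forall x, 0v <=v x -> f x <= f' x) /\
    f' (vabs_sum a n) <= f (vabs_sum a n) + (/ 2) ^ (n + 2) /\
    forall delta, 0 < delta -> exists x, pos_ball X x /\ 1 - (/ 2) ^ S n - delta < f' x).
  assert (Hstep : forall n f, exists f', good n f -> good (S n) f' /\ step n f f').
  { intros n f. destruct (classic (good n f)) as [[H1 H2]|H]; [|now exists f].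
    destruct (enlarge_functional f (1 - (/ 2) ^ n) (1 - (/ 2) ^ S n) ((/ 2) ^ (n + 2))
                (vabs_sum a n)) as [f' Hf'].
    - easy.
    - cbn. pose proof (half_pow_pos n). lra.
    - easy.
    - apply vabs_sum_ge0.
    - apply half_pow_pos.
    - exists f'. intros _. unfold good, step. tauto. }
  (* The start 0 fits the bound [1 - (1/2)^0 = 0]. *)
  pose (F := fix F n := match n with
    | O => fun _ => 0
    | S m => proj1_sig (constructive_indefinite_description _ (Hstep m (F m)))
    end).
  assert (HFs : forall n, good n (F n) -> good (S n) (F (S n)) /\ step n (F n) (F (S n))).
  { intros n. exact (proj2_sig (constructive_indefinite_description _ (Hstep n (F n)))). }
  assert (HFg : forall n, good n (F n)).
  { induction n as [|n IH]; [|now apply HFs].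
    split; [apply positive_dual_zero|]. intros. cbn. lra. }
  exists F. split; [apply HFg|]. split; [apply HFg|].
  split; [|split]; intros n; apply (HFs n (HFg n)).
Qed.

(** On positive vectors the values increase and are bounded by the norm. A general [x] is the
    difference of the positive vectors [x^+] and [x^+ - x]. *)
Lemma increasing_functionals_limit (F : nat -> X -> R) :
  (forall n, positive_dual X (F n)) ->
  (forall n x, pos_ball X x -> F n x <= 1) ->
  (forall n x, 0v <=v x -> F n x <= F (S n) x) ->
  exists f, positive_dual X f /\ forall x, Un_cv (fun n => F n x) (f x).
Proof.
  intros HF HF1 HFm.
  assert (Hcv0 : forall x, 0v <=v x -> exists l, Un_cv (fun n => F n x) l).
  { intros x Hx. destruct (growing_cv (fun n => F n x)) as [l Hl].
    - intros n. now apply HFm.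
    - exists (vnorm X x). intros r [n ->]. apply positive_dual_le_norm; auto.
    - now exists l. }
  assert (Hcv : forall x, exists l, Un_cv (fun n => F n x) l).
  { intros x.
    destruct (Hcv0 (vpos X x)) as [l1 H1]; [apply vpos_ge0|].
    destruct (Hcv0 (vadd X (vpos X x) (vopp X x))) as [l2 H2].
    { pose proof (vpos_ge X x) as H. clear - H. dual_le. }
    exists (l1 - l2).
    replace (fun n => F n x) with
      (fun n => F n (vpos X x) - F n (vadd X (vpos X x) (vopp X x))).
    - now apply CV_minus.
    - apply functional_extensionality; intros n.
      rewrite (pd_add X _ (HF n)), (pd_opp X _ (HF n)). ring. }
  pose (f := fun x => proj1_sig (constructive_indefinite_description _ (Hcv x))).
  assert (Hf : forall x, Un_cv (fun n => F n x) (f x)).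
  { intros x. exact (proj2_sig (constructive_indefinite_description _ (Hcv x))). }
  assert (Hadd : forall x y, f (vadd X x y) = f x + f y).
  { intros x y. apply UL_sequence with (fun n => F n (vadd X x y)); [apply Hf|].
    replace (fun n => F n (vadd X x y)) with (fun n => F n x + F n y).
    - now apply CV_plus.
    - apply functional_extensionality; intros n. now rewrite (pd_add X _ (HF n)). }
  assert (Hscal : forall t x, f (vscal X t x) = t * f x).
  { intros t x. apply UL_sequence with (fun n => F n (vscal X t x)); [apply Hf|].
    replace (fun n => F n (vscal X t x)) with (fun n => t * F n x).
    - apply CV_mult with (An := fun _ => t); [|easy].
      intros eps Heps. exists O. intros n _. now rewrite Rdist_eq.
    - apply functional_extensionality; intros n. now rewrite (pd_scal X _ (HF n)). }
  assert (Hle : forall x, f x <= vnorm X x).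
  { intros x. apply (limit_le _ _ _ O (Hf x)). intros n _.
    apply Rle_trans with (F n (vpos X x)); [apply (pd_mono X _ (HF n)), vpos_ge|].
    eapply Rle_trans; [|apply vnorm_vpos].
    apply positive_dual_le_norm; [easy|auto|apply vpos_ge0]. }
  exists f. split; [split; [split; [easy|split; [easy|]]|]|easy].
  - exists 1. intros x. rewrite Rmult_1_l. apply Rabs_le. split; [|easy].
    pose proof (Hle (vscal X (-1) x)) as H.
    rewrite Hscal, vnorm_scal, (Rabs_left (-1)) in H by lra. lra.
  - intros x Hx. apply Rle_trans with (F O x); [now apply HF|].
    apply (growing_ineq (fun n => F n x)); [|easy]. intros n. now apply HFm.
Qed.

(** The definition is applied to [b <= |b|] with both endpoints equal to [|b|]. So order extreme
    points lie in [pos_ball], where the functionals are compared. *)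
Lemma vabs_order_extreme_point (b : X) :
  order_extreme_point X (unit_ball X) b -> vabs X b = b.
Proof.
  intros [Hb Hext].
  assert (Hab : unit_ball X (vabs X b)) by (eapply Rle_trans; [apply vnorm_abs|exact Hb]).
  apply (Hext (vabs X b) (vabs X b) (/ 2)); [easy|easy|lra|].
  replace (vadd X (vscal X (1 - / 2) (vabs X b)) (vscal X (/ 2) (vabs X b)))
    with (vabs X b) by vec.
  apply vjoin_l.
Qed.

Lemma functional_avoiding (a : nat -> X) :
  exists f, positive_dual X f /\
    forall j, pos_ball X (a j) -> exists x, pos_ball X x /\ f (a j) < f x.
Proof.
  destruct (functional_sequence a) as [F [HF [HF1 [HFm [HFu HFn]]]]].
  destruct (increasing_functionals_limit F HF) as [f [Hf Hlim]].
  { intros n x Hx. pose proof (HF1 n x Hx). pose proof (half_pow_pos n). lra. }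
  { easy. }
  exists f. split; [easy|]. intros j Hj.
  (* The increments [2^-(i+2)] for [j <= i < k] sum to [2^-(j+1) - 2^-(k+1)]. Each increment is a
     positive functional, so its value at [a j] is at most that at the dominating [vabs_sum a i]. *)
  assert (Hup : forall k, (j <= k)%nat ->
            F k (a j) <= F j (a j) + (/ 2) ^ (j + 1) - (/ 2) ^ (k + 1)).
  { induction 1 as [|k Hk IH]; [lra|].
    pose proof (vabs_le_vabs_sum a j k Hk) as Hle.
    rewrite vabs_of_ge0 in Hle by apply Hj.
    assert (H0 : 0v <=v vadd X (vabs_sum a k) (vopp X (a j))) by (clear - Hle; dual_le).
    pose proof (HFm k _ H0) as H.
    rewrite (pd_add X _ (HF k)), (pd_opp X _ (HF k)), (pd_add X _ (HF (S k))),
      (pd_opp X _ (HF (S k))) in H.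
    pose proof (HFu k) as H1.
    assert ((/ 2) ^ (S k + 1) = / 2 * (/ 2) ^ (k + 1)) by easy.
    assert ((/ 2) ^ (k + 2) = / 2 * (/ 2) ^ (k + 1)) by (rewrite !pow_add; cbn; ring).
    lra. }
  assert (Hfa : f (a j) <= 1 - (/ 2) ^ (j + 1)).
  { apply (limit_le _ _ _ j (Hlim (a j))). intros k Hk.
    pose proof (Hup k Hk). pose proof (HF1 j _ Hj). pose proof (half_pow_pos (k + 1)).
    assert ((/ 2) ^ (j + 1) = / 2 * (/ 2) ^ j) by (rewrite pow_add; cbn; ring).
    lra. }
  (* At stage [j + 2] the norm is [1 - 2^-(j+2)]; with an error of [2^-(j+2)] the value at [x] still
     strictly exceeds the bound [1 - 2^-(j+1)] on [f (a j)]. *)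
  destruct (HFn (S j) ((/ 2) ^ (j + 2)) (half_pow_pos _)) as [x [Hx Hlt]].
  exists x. split; [easy|]. apply Rle_lt_trans with (1 := Hfa).
  apply Rlt_le_trans with (F (S (S j)) x).
  - assert ((/ 2) ^ S (S j) = / 2 * (/ 2) ^ (j + 1)) by (rewrite pow_add; cbn; ring).
    assert ((/ 2) ^ (j + 2) = / 2 * (/ 2) ^ (j + 1)) by (rewrite !pow_add; cbn; ring).
    lra.
  - apply (growing_ineq (fun n => F n x)); [|easy]. intros n. apply HFm, Hx.
Qed.

End Construction.

Theorem mainTheorem18 (X : BanachLattice) :
  reflexive X -> infinite_dimensional X ->
  ~ countable_set X (order_extreme_point X (unit_ball X)).
Proof.
  intros Hrefl Hinf [a Ha].
  destruct (functional_avoiding X Hrefl Hinf a) as [f [Hf Havoid]].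
  destruct (positive_dual_argmax X Hrefl (infinite_dimensional_nontrivial X Hinf) f Hf)
    as [b [Hb Hmax]].
  destruct (Ha b Hb) as [j Hj].
  assert (Hbb : pos_ball X b).
  { split; [|apply Hb]. rewrite <- vabs_order_extreme_point by easy. apply vabs_ge0. }
  destruct (Havoid j) as [x [Hx Hlt]]; [now rewrite Hj|].
  rewrite Hj in Hlt. specialize (Hmax x Hx). lra.
Qed.
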